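(* Let $R$ be a ring. Every projectively coresolved Gorenstein flat right $R$-module $K$ belongs to the class ${}^\perp\overline{R_R}$, where $\overline{R_R}$ is the definable closure of $\{R_R\}$ (i.e. $\operatorname{Ext}^1_R(K,D)=0$ for every $D\in\overline{R_R}$). In particular, $K$ is Gorenstein projective.
   Context: $R$ is an associative unital ring; modules are right $R$-modules. A projectively coresolved Gorenstein flat module (PGF-module) is a syzygy module in an acyclic complex $\cdots\to P^{-1}\to P^0\to P^1\to P^2\to\cdots$ of projective modules which remains exact after applying $-\otimes_R I$ for every injective left $R$-module $I$. A module is Gorenstein projective if it is a syzygy in an acyclic complex of projective modules which remains exact after applying $\operatorname{Hom}_R(-,P)$ for every projective module $P$. A class of modules is definable if it is closed under products, direct limits and pure submodules; the definable closure of $\mathcal C$ is the smallest definable class containing $\mathcal C$. *)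

(* Defs.v *)
From HB Require Import structures.
From mathcomp Require Import all_boot all_order all_algebra.
From mathcomp Require Import generic_quotient ring_quotient boolp.
From mathcomp.multinomials Require Import freeg.

Set Implicit Arguments.
Unset Strict Implicit.
Unset Printing Implicit Defensive.

Import GRing.Theory Quotient.Exports.

Local Open Scope ring_scope.
Local Open Scope quotient_scope.

(* A right R-module is a left module over the converse ring R^c, with
   x . r = (r : R^c) *: x; in particular (R^c)^o is the right module R_R. *)
Notation rmodType R := (lmodType R^c).

Definition surjective_fun (A B : Type) (f : A -> B) : Prop :=
  forall b, exists a, f a = b.

Definition exact (A B C : zmodType) (f : A -> B) (g : B -> C) : Prop :=
  forall b, g b = 0 <-> exists a, f a = b.

(* Exactness of Hom(C, D) -> Hom(B, D) -> Hom(A, D) at the middle term. *)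
Definition hom_exact (S : pzRingType) (D A B C : lmodType S)
    (f : {linear A -> B}) (g : {linear B -> C}) : Prop :=
  forall h : {linear B -> D},
    (forall a, h (f a) = 0) <-> exists k : {linear C -> D}, forall b, k (g b) = h b.

Definition projective (S : pzRingType) (P : lmodType S) : Prop :=
  forall (A B : lmodType S) (p : {linear A -> B}) (f : {linear P -> B}),
    surjective_fun p -> exists g : {linear P -> A}, forall x, p (g x) = f x.

Definition injective_module (S : pzRingType) (I : lmodType S) : Prop :=
  forall (A B : lmodType S) (i : {linear A -> B}) (f : {linear A -> I}),
    injective i -> exists g : {linear B -> I}, forall x, g (i x) = f x.

Definition projective_resolution (S : pzRingType) (K : lmodType S)
    (P : nat -> lmodType S) (d : forall n, {linear P n.+1 -> P n})
    (e : {linear P 0%N -> K}) : Prop :=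
  [/\ forall n, projective (P n),
      surjective_fun e,
      exact (d 0%N) e
    & forall n, exact (d n.+1) (d n)].

(* H^1(Hom(P, D)) = 0, for every projective resolution P of K (the cohomology
   does not depend on the resolution, and every module has one). *)
Definition Ext1_eq0 (S : pzRingType) (K D : lmodType S) : Prop :=
  forall (P : nat -> lmodType S) (d : forall n, {linear P n.+1 -> P n})
         (e : {linear P 0%N -> K}),
    projective_resolution d e -> hom_exact D (d 1%N) (d 0%N).

Definition left_orthogonal (S : pzRingType) (C : lmodType S -> Prop)
    (K : lmodType S) : Prop :=
  forall D, C D -> Ext1_eq0 K D.

Section Tensor.
Variables (R : pzRingType) (M : rmodType R) (N : lmodType R).

Local Notation gen m n := (<< (m, n) >> : {freeg (M * N)%type / int}).

Inductive tensor_relation : {freeg (M * N)%type / int} -> Prop :=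
| tensor_rel0 : tensor_relation 0
| tensor_relB u v :
    tensor_relation u -> tensor_relation v -> tensor_relation (u - v)
| tensor_relDl m m' n :
    tensor_relation (gen (m + m') n - gen m n - gen m' n)
| tensor_relDr m n n' :
    tensor_relation (gen m (n + n') - gen m n - gen m n')
| tensor_relM m (r : R) n :
    tensor_relation (gen ((r : R^c) *: m) n - gen m (r *: n)).

Definition tensor_relations : {pred {freeg (M * N)%type / int}} :=
  fun u => `[< tensor_relation u >].

Fact tensor_relations_closed : zmod_closed tensor_relations.
Proof.
split; first by apply/asboolP; exact: tensor_rel0.
by move=> u v /asboolP Hu /asboolP Hv; apply/asboolP; exact: tensor_relB.
Qed.

HB.instance Definition _ :=
  GRing.isZmodClosed.Build _ tensor_relations tensor_relations_closed.

Definition tensor : zmodType := Quotient.quot tensor_relations.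

Definition tens (m : M) (n : N) : tensor :=
  \pi_(Quotient.quot tensor_relations) (gen m n).

Record balanced (A : zmodType) (b : M -> N -> A) : Prop := Balanced {
  balancedDl : forall m m' n, b (m + m') n = b m n + b m' n;
  balancedDr : forall m n n', b m (n + n') = b m n + b m n';
  balancedM : forall m (r : R) n, b ((r : R^c) *: m) n = b m (r *: n)
}.

(* Meaningful when b is balanced: it is then the unique additive map sending
   tens m n to b m n (tensor_liftE, tensor_lift_is_zmod_morphism,
   tensor_lift_unique). *)
Definition tensor_lift (A : zmodType) (b : M -> N -> A) (x : tensor) : A :=
  fglift (fun p => b p.1 p.2 : zmodule A)
    (repr (x : Quotient.quot tensor_relations)).

Lemma tensor_piP (u v : {freeg (M * N)%type / int}) :
  reflect (\pi_(Quotient.quot tensor_relations) u =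
           \pi_(Quotient.quot tensor_relations) v) (u - v \in tensor_relations).
Proof. by rewrite Quotient.idealrBE; exact: eqP. Qed.

Lemma tens_balanced : balanced tens.
Proof.
split=> [m m' n|m n n'|m r n]; rewrite /tens -?raddfD; apply/tensor_piP/asboolP.
- by rewrite opprD addrA; exact: tensor_relDl.
- by rewrite opprD addrA; exact: tensor_relDr.
- exact: tensor_relM.
Qed.

Section Lift.
Variables (A : zmodType) (b : M -> N -> A) (bal : balanced b).

Local Notation lift_gen := (fglift (fun p => b p.1 p.2 : zmodule A)).

Fact lift_genB u v : lift_gen (u - v) = lift_gen u - lift_gen v.
Proof. exact: lift_is_additive. Qed.

Fact lift_gen1 m n : lift_gen (gen m n) = b m n.
Proof. by rewrite liftU scale1r. Qed.

Fact lift_gen_rel u : tensor_relation u -> lift_gen u = 0.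
Proof.
elim=> [|{}u v _ Hu _ Hv|m m' n|m n n'|m r n].
- by rewrite -(subrr 0) lift_genB subrr.
- by rewrite lift_genB Hu Hv subrr.
- by rewrite !lift_genB !lift_gen1 (balancedDl bal) addrAC addrK subrr.
- by rewrite !lift_genB !lift_gen1 (balancedDr bal) addrAC addrK subrr.
- by rewrite lift_genB !lift_gen1 (balancedM bal) subrr.
Qed.

Lemma tensor_lift_pi u :
  tensor_lift b (\pi_(Quotient.quot tensor_relations) u) = lift_gen u.
Proof.
apply/eqP; rewrite -subr_eq0 -lift_genB; apply/eqP/lift_gen_rel/asboolP.
by apply/tensor_piP; rewrite reprK.
Qed.

Lemma tensor_liftE m n : tensor_lift b (tens m n) = b m n.
Proof. by rewrite tensor_lift_pi lift_gen1. Qed.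

Lemma tensor_lift_is_zmod_morphism : zmod_morphism (tensor_lift b).
Proof.
move=> x y; rewrite -[x]reprK -[y]reprK.
by rewrite -[in LHS]raddfB !tensor_lift_pi lift_genB.
Qed.

Lemma tensor_lift_unique (g : tensor -> A) :
    zmod_morphism g -> (forall m n, g (tens m n) = b m n) ->
  g =1 tensor_lift b.
Proof.
move=> gB gE x; rewrite -[x]reprK tensor_lift_pi.
pose G : {freeg (M * N)%type / int} -> A :=
  fun u => g (\pi_(Quotient.quot tensor_relations) u).
have GB : zmod_morphism G by move=> u v; rewrite /G raddfB gB.
pose gaddM := GRing.isZmodMorphism.Build _ _ G GB.
pose Ga : {additive {freeg (M * N)%type / int} -> A} := HB.pack G gaddM.
pose laddM := GRing.isZmodMorphism.Build _ _ lift_gen lift_genB.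
pose La : {additive {freeg (M * N)%type / int} -> A} := HB.pack lift_gen laddM.
change (Ga (repr x) = La (repr x)).
rewrite -(freeg_sumE (repr x)) !raddf_sum; apply: eq_bigr => -[m n] _.
set c := coeff _ _; rewrite -[c]intz -freeg_mulz !raddfMz.
by congr (_ *~ _); rewrite [LHS]gE [RHS]lift_gen1.
Qed.

End Lift.

End Tensor.

Definition tensor_map (R : pzRingType) (M M' : rmodType R) (f : {linear M -> M'})
    (N : lmodType R) : tensor M N -> tensor M' N :=
  tensor_lift (fun m n => tens (f m) n).

Lemma tensor_mapE (R : pzRingType) (M M' : rmodType R) (f : {linear M -> M'})
  (N : lmodType R) m n : tensor_map f (tens m n) = tens (f m) n :> tensor M' N.
Proof.
apply: tensor_liftE; have [bDl bDr bM] := tens_balanced M' N.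
by split=> *; rewrite ?linearD ?linearZ ?bDl ?bDr ?bM.
Qed.

Definition acyclic_complex (S : pzRingType) (P : int -> lmodType S)
    (d : forall n, {linear P n -> P (n + 1)}) : Prop :=
  forall n, exact (d n) (d (n + 1)).

(* K is isomorphic to the kernel of some d n (equivalently, by acyclicity, to
   the image of some d n). *)
Definition is_syzygy (S : pzRingType) (P : int -> lmodType S)
    (d : forall n, {linear P n -> P (n + 1)}) (K : lmodType S) : Prop :=
  exists (n : int) (i : {linear K -> P n}), injective i /\ exact i (d n).

Definition PGF (R : pzRingType) (K : rmodType R) : Prop :=
  exists (P : int -> rmodType R) (d : forall n, {linear P n -> P (n + 1)}),
    [/\ forall n, projective (P n),
        acyclic_complex d,
        forall I : lmodType R, injective_module I ->
          forall n, exact (tensor_map (d n) (N := I)) (tensor_map (d (n + 1)) (N := I))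
      & is_syzygy d K].

Definition Gorenstein_projective (S : pzRingType) (K : lmodType S) : Prop :=
  exists (P : int -> lmodType S) (d : forall n, {linear P n -> P (n + 1)}),
    [/\ forall n, projective (P n),
        acyclic_complex d,
        forall Q : lmodType S, projective Q ->
          forall n, hom_exact Q (d n) (d (n + 1))
      & is_syzygy d K].

Definition is_product (S : pzRingType) (I : Type) (M : I -> lmodType S)
    (L : lmodType S) (p : forall i, {linear L -> M i}) : Prop :=
  forall (X : lmodType S) (q : forall i, {linear X -> M i}),
    exists f : {linear X -> L},
      (forall i x, p i (f x) = q i x) /\
      forall f' : {linear X -> L}, (forall i x, p i (f' x) = q i x) -> f' =1 f.

Definition directed (disp : Order.disp_t) (I : porderType disp) : Prop :=
  inhabited I /\ forall i j : I, exists k, (i <= k)%O /\ (j <= k)%O.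

Definition direct_system (S : pzRingType) (disp : Order.disp_t)
    (I : porderType disp) (M : I -> lmodType S)
    (phi : forall i j, (i <= j)%O -> {linear M i -> M j}) : Prop :=
  (forall i (h : (i <= i)%O), phi i i h =1 id) /\
  (forall i j k (hij : (i <= j)%O) (hjk : (j <= k)%O) (hik : (i <= k)%O),
     phi j k hjk \o phi i j hij =1 phi i k hik).

Definition cocone (S : pzRingType) (disp : Order.disp_t)
    (I : porderType disp) (M : I -> lmodType S)
    (phi : forall i j, (i <= j)%O -> {linear M i -> M j})
    (X : lmodType S) (q : forall i, {linear M i -> X}) : Prop :=
  forall i j (h : (i <= j)%O), q j \o phi i j h =1 q i.

Definition is_direct_limit (S : pzRingType) (disp : Order.disp_t)
    (I : porderType disp) (M : I -> lmodType S)
    (phi : forall i j, (i <= j)%O -> {linear M i -> M j})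
    (L : lmodType S) (psi : forall i, {linear M i -> L}) : Prop :=
  cocone phi psi /\
  forall (X : lmodType S) (q : forall i, {linear M i -> X}),
    cocone phi q ->
    exists f : {linear L -> X},
      (forall i x, f (psi i x) = q i x) /\
      forall f' : {linear L -> X}, (forall i x, f' (psi i x) = q i x) -> f' =1 f.

Definition pure_mono (R : pzRingType) (M L : rmodType R)
    (i : {linear M -> L}) : Prop :=
  injective i /\
  forall N : lmodType R, injective (tensor_map i (N := N)).

(* Closure under isomorphic copies is implied: products are taken up to
   isomorphism, and a module is a product of the one-member family it forms. *)
Record definable (R : pzRingType) (C : rmodType R -> Prop) : Prop := Definable {
  definable_product : forall (I : Type) (M : I -> rmodType R) (L : rmodType R)
    (p : forall i, {linear L -> M i}),
    is_product p -> (forall i, C (M i)) -> C L;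
  definable_direct_limit : forall (disp : Order.disp_t) (I : porderType disp)
    (M : I -> rmodType R) (phi : forall i j, (i <= j)%O -> {linear M i -> M j})
    (L : rmodType R) (psi : forall i, {linear M i -> L}),
    directed I -> direct_system phi -> is_direct_limit phi psi ->
    (forall i, C (M i)) -> C L;
  definable_pure : forall (M L : rmodType R) (i : {linear M -> L}),
    pure_mono i -> C L -> C M
}.

Definition definable_closure (R : pzRingType) (C : rmodType R -> Prop)
    (D : rmodType R) : Prop :=
  forall X : rmodType R -> Prop, definable X -> (forall M, C M -> X M) -> X D.

Definition regular_rmodule (R : pzRingType) : rmodType R := (R^c)^o.

(* Main.v *)
(* Let P be the complex of projectives of K and D a right module. In terms of
   dual bases of the P n, a cochain with values in D is a function h : X -> D
   on the set X of all elements of all P n, and the projection e onto the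
   actual cochains and the differential d become row-finite matrices.

   The heart of the matter is the following finitary condition: for every
   finite F there is a finite G such that dh = 0 on G implies dw = eh on F for
   some w. It holds for D = R: otherwise choose a counterexample for every G,
   separate it from the solvable systems by a character with values in Q/Z, and
   collect all these characters in one injective module I = (R^+)^J; they form
   a cycle of P (x) I, and the finite set G involved in writing it as a boundary
   gives a contradiction. For fixed F and G the condition defines a definable
   class of modules, and it passes from R to projective modules.

   Conversely the condition makes Hom(P, D) exact: when X is countable a
   Mittag-Leffler argument lifts cocycles, and in general X is exhausted by
   subsystems that satisfy the condition themselves, each one countable over the
   previous one. *)
From HB Require Import structures.
Require Import Defs.
From mathcomp Require Import all_boot all_order all_algebra.
From mathcomp Require Import generic_quotient ring_quotient zify.
From mathcomp Require Import boolp classical_sets functions.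

Set Implicit Arguments.
Unset Strict Implicit.
Unset Printing Implicit Defensive.

Import Order.TTheory GRing.Theory Num.Theory Quotient.Exports.

Local Open Scope ring_scope.
Local Open Scope quotient_scope.
Local Open Scope classical_set_scope.

(** * Exactness from finite solvability *)

(** Zorn's lemma for partial functions. A pair holds a domain and a total function, and the order
    compares values on the smaller domain only. *)
Lemma partial_extension (X Y : Type) (good : set X -> (X -> Y) -> Prop)
    (S0 : set X) (f0 : X -> Y) :
    (forall (C : set (set X * (X -> Y))) f,
       C !=set0 -> (forall c, C c -> good c.1 c.2) ->
       total_on C (fun c c' => c.1 `<=` c'.1) ->
       (forall c, C c -> {in c.1, f =1 c.2}) ->
       good (\bigcup_(c in C) c.1) f) ->
    (forall S f x, good S f ->
       exists S' f', [/\ good S' f', S `<=` S', S' x & {in S, f' =1 f}]) ->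
    good S0 f0 ->
  exists f, good setT f /\ {in S0, f =1 f0}.
Proof.
move=> chain step good0.
pose T := {c : set X * (X -> Y) | good c.1 c.2}.
pose le (c c' : set X * (X -> Y)) := c.1 `<=` c'.1 /\ {in c.1, c'.2 =1 c.2}.
pose leb (c c' : T) := `[< le (sval c) (sval c') >].
have le_refl c : le c c by split.
have le_trans c' c c'' : le c c' -> le c' c'' -> le c c''.
  move=> [s1 e1] [s2 e2]; split=> [|x cx]; first exact: subset_trans s2.
  by rewrite e2 ?e1 //; apply/mem_set/s1/set_mem.
pose c0 : T := exist (fun c => good c.1 c.2) (S0, f0) good0.
pose T0 := {c : T | le (sval c0) (sval c)}.
pose le0 (c c' : T0) := leb (sval c) (sval c').
have [||C Ctot|[[[S f] goodS] sub0] max] :=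
    ZL_preorder (exist (fun c : T => le (sval c0) (sval c)) c0 (le_refl _))
      (R := le0).
- by move=> c; apply/asboolP.
- by move=> a b c /asboolP ab /asboolP bc; apply/asboolP/(le_trans (sval (sval b))).
- have [[c1 Cc1]|C0] := pselect (exists c, C c); last first.
    by exists (exist _ c0 (le_refl _)) => c Cc; case: C0; exists c.
  pose D := [set c | exists2 c', C c' & c = sval (sval c')].
  have Dtot c c' : D c -> D c' -> le c c' \/ le c' c.
    move=> [a Ca ->] [b Cb ->].
    by have [/asboolP|/asboolP] := Ctot _ _ Ca Cb; [left|right].
  (* Members of a chain agree wherever both are defined, so their values glue; outside the union
     [f0] is a filler. *)
  have /choice[f fP] x : exists y, forall c, D c -> c.1 x -> y = c.2 x.
    have [[c [Dc cx]]|no] := pselect (exists c, D c /\ c.1 x); last first.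
      by exists (f0 x) => c Dc cx; case: no; exists c.
    exists (c.2 x) => c' Dc' c'x.
    have [[_ e]|[_ e]] := Dtot _ _ Dc Dc'; last by apply: e; exact/mem_set.
    by symmetry; apply: e; exact/mem_set.
  have goodf : good (\bigcup_(c in D) c.1) f.
    apply: chain => [|c [c' _ ->]|c c' Dc Dc'|c Dc x /set_mem cx].
    - by exists (sval (sval c1)), c1.
    - exact: (svalP (sval c')).
    - by have [[s _]|[s _]] := Dtot _ _ Dc Dc'; [left|right].
    - exact: fP.
  have ub c : D c -> le c (\bigcup_(c in D) c.1, f).
    move=> Dc; split=> [x cx|x /set_mem cx] /=; first by exists c.
    exact: fP.
  have le1 : le (sval c0) (\bigcup_(c in D) c.1, f).
    by apply: le_trans (svalP c1) (ub _ _); exists c1.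
  exists (exist _ (exist (fun c => good c.1 c.2) (\bigcup_(c in D) c.1, f) goodf) le1).
  by move=> c Cc; apply/asboolP/ub; exists c.
- exists f; split; last exact: (proj2 sub0).
  suff -> : [set: X] = S by [].
  apply/seteqP; split=> // x _.
  have [S' [f' [goodS' SS' S'x eqf]]] := step S f x goodS.
  have le' : le (S, f) (S', f') by split.
  have le0' : le (sval c0) (S', f') by apply: le_trans le'.
  pose c' : T0 := exist _ (exist (fun c => good c.1 c.2) (S', f') goodS') le0'.
  have /asboolP[/= + _] : le0 c' (exist _ (exist (fun c => good c.1 c.2) (S, f) goodS) sub0).
    by apply: max; apply/asboolP.
  exact.
Qed.
Lemma mem_flatten_map (X Y : eqType) (f : X -> seq Y) (F : seq X) x y :
  x \in F -> y \in f x -> y \in flatten (map f F).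
Proof. by move=> xF yx; apply/flatten_mapP; exists x. Qed.

Section DifferentialSystem.
Variables (X : eqType) (D : zmodType) (d e : {additive (X -> D) -> (X -> D)}).
Variables (sd se : X -> seq X).

Hypothesis d_local : forall h h' x, {in sd x, h =1 h'} -> d h x = d h' x.
Hypothesis e_local : forall h h' x, {in se x, h =1 h'} -> e h x = e h' x.
Hypothesis dd0 : forall h, d (d h) = 0.
Hypothesis ee : forall h, e (e h) = e h.
Hypothesis ed : forall h, e (d h) = d h.
Hypothesis de : forall h, d (e h) = d h.

Definition solvable (F G : seq X) : Prop :=
  forall h : X -> D, {in G, forall x, d h x = 0} ->
  exists w, {in F, d w =1 e h}.

(** Closure of the index set under supports: the functions vanishing on [Y] then form a
    subcomplex. *)
Definition stable (Y : set X) : Prop :=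
  forall x, Y x -> (forall y, y \in sd x -> Y y) /\ (forall y, y \in se x -> Y y).

(** The finitary condition for the subsystem on [Y]; the point is that [G] stays inside [Y]. *)
Definition locally_solvable (Y : set X) : Prop :=
  forall F : seq X, (forall x, x \in F -> Y x) ->
  exists2 G : seq X, (forall x, x \in G -> Y x) & solvable F G.

Definition vanishes (Y : set X) (h : X -> D) : Prop := forall x, Y x -> h x = 0.

Definition off (Y : set X) (h : X -> D) : X -> D :=
  fun x => if x \in Y then 0 else h x.

Lemma off_in Y h x : Y x -> off Y h x = 0.
Proof. by move=> /mem_set; rewrite /off => ->. Qed.

Lemma off_notin Y h x : ~ Y x -> off Y h x = h x.
Proof. by move=> nYx; rewrite /off memNset. Qed.

Lemma d_vanishes Y h : stable Y -> vanishes Y h -> vanishes Y (d h).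
Proof.
move=> stY hY x Yx; rewrite (@d_local _ 0) ?raddf0 // => y yx.
by rewrite hY //; exact: (stY x Yx).1.
Qed.

Lemma e_vanishes Y h : stable Y -> vanishes Y h -> vanishes Y (e h).
Proof.
move=> stY hY x Yx; rewrite (@e_local _ 0) ?raddf0 // => y yx.
by rewrite hY //; exact: (stY x Yx).2.
Qed.

Lemma vanishesB Y h h' : vanishes Y h -> vanishes Y h' -> vanishes Y (h - h').
Proof. by move=> hY h'Y x Yx; rewrite !fctE hY ?h'Y ?subr0. Qed.

Lemma vanishesD Y h h' : vanishes Y h -> vanishes Y h' -> vanishes Y (h + h').
Proof. by move=> hY h'Y x Yx; rewrite !fctE hY ?h'Y ?addr0. Qed.

Hypothesis solvableX : forall F, exists G, solvable F G.

(* Solvability passes to the quotient by the span of Y: a solution w over F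
   need not vanish on Y, but it is a cocycle on a part of Y large enough to
   make it a coboundary on the support of dF inside Y. *)
Lemma solvable_off Y (F : seq X) : stable Y -> locally_solvable Y ->
  exists G : seq X, forall h, vanishes Y h -> {in G, forall x, d h x = 0} ->
  exists w, [/\ vanishes Y w, e w = w & {in F, d w =1 e h}].
Proof.
move=> stY solY.
pose F2 := [seq y <- flatten (map sd F) | y \in Y].
have [|G1 G1Y sol1] := solY F2.
  by move=> y; rewrite mem_filter => /andP[/set_mem].
have [G sol] := solvableX (F ++ G1); exists G => h hY dh.
have [w dw] := sol h dh.
have [|v dv] := sol1 w.
  move=> x xG1; rewrite dw ?mem_cat ?xG1 ?orbT //.
  exact/(e_vanishes stY hY)/G1Y.
(* [w'] has the same differential as [w] and vanishes on [F2], so cutting it off along [Y] leaves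
   its differential on [F] unchanged. *)
pose w' := e w - d v.
have dw' : d w' = d w by rewrite raddfB /= de dd0 subr0.
exists (e (off Y w')); split; last 2 first.
- exact: ee.
- move=> x xF; rewrite de (@d_local _ w') ?dw' => [|y yx].
    by rewrite dw // mem_cat xF.
  have [Yy|nYy] := pselect (Y y); last exact: off_notin.
  rewrite off_in // /w' !fctE dv ?subrr // mem_filter mem_set //=.
  exact: mem_flatten_map yx.
- by apply: e_vanishes => // x Yx; exact: off_in.
Qed.

(** * Enlarging a solved subsystem by a countable hull *)

Section CountableStep.
Variables (Y : set X) (stableY : stable Y) (solY : locally_solvable Y).
Variables (GY : seq X -> seq X) (x0 : X).
Hypothesis GYP : forall F h, vanishes Y h -> {in GY F, forall x, d h x = 0} ->
  exists w, [/\ vanishes Y w, e w = w & {in F, d w =1 e h}].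

(** Each finite stage adds the supports of its rows under both operators and the test set [GY] of
    the whole stage. A function that vanishes on [Y] and is closed on one stage is thus, up to [e],
    a coboundary on the stage before. *)
Fixpoint hull (k : nat) : seq X :=
  if k is k'.+1 then
    hull k' ++ flatten (map sd (hull k')) ++ flatten (map se (hull k'))
            ++ GY (hull k')
  else [:: x0].

Definition extended : set X := Y `|` [set x | exists k, x \in hull k].

Lemma hullS k : {subset hull k <= hull k.+1}.
Proof. by move=> x xk; rewrite /= mem_cat xk. Qed.

Lemma hull_le k l : (k <= l)%N -> {subset hull k <= hull l}.
Proof.
move=> /subnKC <-; elim: (l - k)%N => [|m IH]; first by rewrite addn0.
by rewrite addnS => x /IH; exact: hullS.
Qed.

Lemma hull_sd k x y : x \in hull k -> y \in sd x -> y \in hull k.+1.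
Proof.
by move=> xk yx; rewrite /= !mem_cat (mem_flatten_map xk yx) orbT.
Qed.

Lemma hull_se k x y : x \in hull k -> y \in se x -> y \in hull k.+1.
Proof.
by move=> xk yx; rewrite /= !mem_cat (mem_flatten_map xk yx) !orbT.
Qed.

Lemma hull_GY k : {subset GY (hull k) <= hull k.+1}.
Proof. by move=> x xk; rewrite /= !mem_cat xk !orbT. Qed.

Lemma stable_extended : stable extended.
Proof.
move=> x [Yx|[k xk]].
  by split=> y yx; left; [exact: (stableY Yx).1|exact: (stableY Yx).2].
by split=> y yx; right; exists k.+1; [exact: hull_sd yx|exact: hull_se yx].
Qed.

Lemma hull_bound (F : seq X) : (forall x, x \in F -> exists k, x \in hull k) ->
  exists k, {subset F <= hull k}.
Proof.
elim: F => [_|x F IH FC]; first by exists 0%N.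
have [|k Fk] := IH; first by move=> y yF; apply: FC; rewrite inE yF orbT.
have [|l xl] := FC x; first exact: mem_head.
exists (maxn k l) => y /predU1P[->|/Fk].
  exact: hull_le (leq_maxr _ _) _ xl.
exact: hull_le (leq_maxl _ _) _.
Qed.

(** The system is solved in two rounds: on [Y] by [solY], then on the hull by [GYP], applied to the
    remainder cut off along [Y]. *)
Lemma locally_solvable_extended : locally_solvable extended.
Proof.
move=> F FY.
have [|k Fk] := @hull_bound [seq x <- F | x \notin Y].
  move=> x; rewrite mem_filter => /andP[/negP xY /FY[Yx|//]].
  by case: xY; exact: mem_set.
pose G2 := hull k.+1.
(* [E] contains every point of [Y] at which the remainder [h'] will be read. Since [h'] vanishes on
   [E], cutting it off along [Y] goes unnoticed. *)
pose E := [seq x <- F ++ flatten (map sd G2) ++ flatten (map se G2) | x \in Y].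
have [|G1 G1Y sol1] := solY (F := E).
  by move=> x; rewrite mem_filter => /andP[/set_mem].
exists (G1 ++ G2) => [x|h dh].
  by rewrite mem_cat => /orP[/G1Y|]; [left|right; exists k.+1].
have [|w dw] := sol1 h; first by move=> x xG; apply: dh; rewrite mem_cat xG.
have dhG2 x : x \in G2 -> d h x = 0.
  by move=> xG2; apply: dh; rewrite mem_cat xG2 orbT.
pose h' := e h - d w.
have h'E : {in E, forall x, h' x = 0}.
  by move=> x /dw; rewrite /h' !fctE => ->; rewrite subrr.
have dh' : d h' = d h by rewrite raddfB /= de dd0 subr0.
have eh' : e h' = h' by rewrite raddfB /= ee ed.
have offE x : (x \in Y -> x \in E) -> off Y h' x = h' x.
  move=> xE; have [Yx|nYx] := pselect (Y x); last exact: off_notin.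
  by rewrite off_in // h'E // xE // mem_set.
have [x Yx|x xG|w' [w'Y _ dw']] := @GYP (hull k) (off Y h').
- exact: off_in.
- have xG2 : x \in G2 by exact: hull_GY.
  rewrite (@d_local _ h') ?dh' ?dhG2 // => y yx.
  apply: offE => Yy; rewrite mem_filter Yy !mem_cat.
  by rewrite (mem_flatten_map xG2 yx) !orbT.
exists (w + w') => x xF; rewrite raddfD /= !fctE.
have [Yx|nYx] := pselect (Y x).
  rewrite (d_vanishes stableY w'Y Yx) addr0 dw //.
  by rewrite mem_filter mem_set // mem_cat xF.
have xk : x \in hull k by apply: Fk; rewrite mem_filter memNset.
rewrite dw' // (@e_local _ h') => [|y yx]; first by rewrite eh' /h' !fctE addrC subrK.
apply: offE => Yy; rewrite mem_filter Yy !mem_cat.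
by rewrite (mem_flatten_map (hullS xk) yx) !orbT.
Qed.

(* A Mittag-Leffler argument along the chain hull k. *)
Lemma solve_extended h : vanishes Y h -> d h = 0 -> e h = h ->
  exists w, vanishes Y w /\ (forall x, extended x -> d w x = h x).
Proof.
move=> hY dh eh.
(* The margin of one stage makes the difference of two approximations closed on [GY (hull k)]. *)
pose approx k w := [/\ vanishes Y w, e w = w & {in hull k.+1, d w =1 h}].
have approxP k : exists w, approx k w.
  have [|x _|w [wY ew dw]] := @GYP (hull k.+1) h => //; first by rewrite dh.
  by exists w; split=> // x xk; rewrite dw // eh.
(* A finer solution [t] differs from [w] by a cocycle on [hull k.+1], hence by some [d v] on
   [hull k]; adding [d v] to [t] restores [w] there. *)
have step k w : approx k w -> exists w', approx k.+1 w' /\ {in hull k, w' =1 w}.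
  move=> [wY ew dw]; have [t [tY et dt]] := approxP k.+1.
  have [x|x xG|v [vY _ dv]] := @GYP (hull k) (w - t).
  - exact: vanishesB.
  - have xk := hull_GY xG.
    by rewrite raddfB /= !fctE dw // dt ?subrr //; exact: hullS.
  exists (t + d v); split; first split.
  - by apply: vanishesD => //; exact: d_vanishes.
  - by rewrite raddfD /= et ed.
  - by move=> x xk; rewrite raddfD /= dd0 addr0 dt.
  - by move=> x xk; rewrite !fctE dv // raddfB /= ew et !fctE addrC subrK.
have [u0 u0P] := approxP 0%N.
have /choice[f fP] (kw : nat * (X -> D)) : exists w', approx kw.1 kw.2 ->
    approx kw.1.+1 w' /\ {in hull kw.1, w' =1 kw.2}.
  have [/step[w' w'P]|n] := pselect (approx kw.1 kw.2); first by exists w'.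
  by exists 0 => /n.
pose u := fix u k := if k is k'.+1 then f (k', u k') else u0.
have uP k : approx k (u k).
  by elim: k => // k IH; exact: (fP (k, u k) IH).1.
have u_le k l : (k <= l)%N -> {in hull k, u l =1 u k}.
  move=> /subnKC <-; elim: (l - k)%N => [|m IH] x xk; first by rewrite addn0.
  rewrite addnS -IH //; apply: (fP (_, u _) (uP _)).2.
  exact: hull_le (leq_addr _ _) _ xk.
have /choice[w wP] x : exists y, (Y x -> y = 0) /\ (forall k, x \in hull k -> y = u k x).
  have [[k xk]|no] := pselect (exists k, x \in hull k); last first.
    by exists 0; split=> // k xk; case: no; exists k.
  exists (u k x); split=> [Yx|l xl]; first by have [uY _ _] := uP k; exact: uY.
  by case: (leqP k l) => [kl|/ltnW lk]; [rewrite (u_le k l)|rewrite (u_le l k)].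
have wY : vanishes Y w by move=> x /(wP x).1.
exists w; split=> // x [Yx|[k xk]].
  by rewrite (d_vanishes stableY wY Yx) hY.
rewrite (@d_local _ (u k.+1)) => [|y yx].
  have [_ _ du] := uP k.+1; rewrite du //; do 2!apply: hullS.
  exact: xk.
exact: (wP y).2 k.+1 (hull_sd xk yx).
Qed.

End CountableStep.

(** Zorn's lemma over solutions on stable, locally solvable sets [Y]. Local solvability survives
    unions of chains because a finite [F] lies in a single member, and it is what allows the next
    countable step. *)
Lemma differential_system_exact h : d h = 0 -> exists w, d w = e h.
Proof.
move=> dh.
pose good (Y : set X) w :=
  [/\ stable Y, locally_solvable Y & forall x, Y x -> d w x = e h x].
have [C f [c1 Cc1] goodC tot agree|Y w x [stY solY dw]||w [[_ _ dw] _]] :=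
    @partial_extension _ _ good set0 0.
- have fE c x : C c -> c.1 x -> f x = c.2 x by move=> Cc cx; apply/agree/mem_set.
  split.
  + move=> x [c Cc cx]; have [st _ _] := goodC c Cc.
    by split=> y yx; exists c => //; [exact: (st x cx).1|exact: (st x cx).2].
  + move=> F FC.
    have [c Cc Fc] : exists2 c, C c & forall x, x \in F -> c.1 x.
      elim: F FC => [_|x F IH FC]; first by exists c1.
      have [|c Cc Fc] := IH; first by move=> y yF; apply: FC; rewrite inE yF orbT.
      have [|c' Cc' c'x] := FC x; first exact: mem_head.
      have [cc'|c'c] := tot _ _ Cc Cc'.
        by exists c' => // y /predU1P[->|/Fc /cc'].
      by exists c => // y /predU1P[->|/Fc//]; exact: c'c.
    have [_ sol _] := goodC c Cc; have [G Gc solG] := sol F Fc.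
    by exists G => // x xG; exists c => //; exact: Gc.
  + move=> x [c Cc cx]; have [st _ <- //] := goodC c Cc.
    by apply: d_local => y yx; apply: fE Cc _; exact: (st x cx).1.
- have /choice[GY GYP] := fun F => solvable_off F stY solY.
  pose w0 : X -> D := fun y => if y \in Y then w y else 0.
  have w0E y : Y y -> w0 y = w y by move=> /mem_set; rewrite /w0 => ->.
  have dw0 y : Y y -> d w0 y = e h y.
    move=> Yy; rewrite -dw //; apply: d_local => z zy.
    by apply: w0E; exact: (stY y Yy).1.
  (* The defect [e h - d w0] is a cocycle fixed by [e] and vanishing on [Y]. Its solution [u]
     vanishes on [Y] too, so the old values are kept. *)
  have [y Yy|||u [uY du]] := solve_extended stY x GYP (h := e h - d w0).
  + by rewrite !fctE dw0 // subrr.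
  + by rewrite raddfB /= de dh dd0 subr0.
  + by rewrite raddfB /= ee ed.
  exists (extended Y GY x), (w0 + u); split.
  + split; [exact: stable_extended|exact: locally_solvable_extended|].
    by move=> y yY'; rewrite raddfD /= !fctE du // !fctE addrC subrK.
  + by move=> y Yy; left.
  + by right; exists 0%N; rewrite inE.
  + by move=> y /set_mem Yy; rewrite !fctE uY // addr0 w0E.
- split=> // F F0; case: F F0 => [_|x F F0]; last by case: (F0 x (mem_head _ _)).
  by exists [::] => // k _; exists 0.
- by exists w; apply/funext => x; exact: dw.
Qed.

End DifferentialSystem.

(** * Characters with values in Q/Z *)

Definition subgroup (A : zmodType) (U : set A) : Prop :=
  U 0 /\ forall x y, U x -> U y -> U (x - y).

Lemma exists_quotient_group (A : zmodType) (U : set A) : subgroup U ->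
  exists (Q : zmodType) (p : {additive A -> Q}),
    surjective_fun p /\ forall x, p x = 0 <-> U x.
Proof.
move=> [U0 UB]; pose P : {pred A} := fun x => `[< U x >].
have Pcl : zmod_closed P.
  split=> [|x y /asboolP Ux /asboolP Uy]; first exact/asboolP.
  by apply/asboolP; exact: UB.
pose Pz : zmodClosed A := HB.pack P (GRing.isZmodClosed.Build A P Pcl).
exists (Quotient.quot Pz), (\pi_(Quotient.quot Pz)); split=> [y|x].
  by exists (repr (y : Quotient.quot Pz)); exact: reprK.
have pE : (x == 0 %[mod Quotient.quot Pz]) = `[< U x >].
  by rewrite -Quotient.idealrBE subr0.
have p0 : \pi_(Quotient.quot Pz) 0 = 0 by exact: raddf0.
rewrite -p0; split=> [/eqP|Ux]; first by rewrite pE => /asboolP.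
by apply/eqP; rewrite pE; exact/asboolP.
Qed.

Definition divisible_group (E : zmodType) : Prop :=
  forall (n : nat) (x : E), (0 < n)%N -> exists y, y *+ n = x.

(** The case [n = 0] is included on purpose: it asks for a non-zero element and serves elements of
    infinite order. *)
Definition has_torsion (E : zmodType) : Prop :=
  forall n : nat, n != 1%N -> exists2 y : E, y != 0 & y *+ n = 0.

(* The group is Q/Z. *)
Lemma exists_divisible_torsion : exists E : zmodType,
  divisible_group E /\ has_torsion E.
Proof.
have [|E [p [p_surj p0]]] := @exists_quotient_group rat [set x | x \is a Num.int].
  by split=> [|x y]; rewrite /= ?rpred0 //; exact: rpredB.
have inv_neq0 (n : nat) : (1 < n)%N -> p n%:R^-1 != 0.
  move=> n_gt1; apply/eqP => /p0 /= /intrP[m nm].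
  have n0 : n%:R != 0 :> rat by rewrite pnatr_eq0; lia.
  have : (1 : int) = m * n by apply: (@intr_inj rat); rewrite intrM -nm mulVf.
  by have [] : (m <= 0)%R \/ (1 <= m)%R by [lia]; nia.
exists E; split=> [n x n_gt0|n n_neq1].
  have [y <-] := p_surj x; exists (p (y / n%:R)).
  by rewrite -raddfMn /= -(mulr_natr (y / _)) divfK // pnatr_eq0 -lt0n.
have [->|n_gt0] := posnP n; first by exists (p 2%:R^-1); rewrite ?inv_neq0.
exists (p n%:R^-1); first by apply: inv_neq0; lia.
rewrite -raddfMn /=; apply/p0.
by rewrite /= -(mulr_natr n%:R^-1) mulVf ?rpred1 // pnatr_eq0 -lt0n.
Qed.

Lemma subgroupN (A : zmodType) (U : set A) x : subgroup U -> U x -> U (- x).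
Proof. by move=> [U0 UB] Ux; rewrite -sub0r; exact: UB. Qed.

Lemma subgroupD (A : zmodType) (U : set A) x y :
  subgroup U -> U x -> U y -> U (x + y).
Proof.
move=> sU Ux Uy; rewrite -[y]opprK; apply: sU.2 => //; exact: subgroupN.
Qed.

Lemma subgroupMn (A : zmodType) (U : set A) x n : subgroup U -> U x -> U (x *+ n).
Proof.
move=> sU Ux; elim: n => [|n IH]; first by rewrite mulr0n; exact: sU.1.
by rewrite mulrS; exact: subgroupD.
Qed.

Lemma subgroupMz (A : zmodType) (U : set A) x (n : int) :
  subgroup U -> U x -> U (x *~ n).
Proof.
move=> sU Ux; case: n => n; first exact: subgroupMn.
by rewrite NegzE mulrNz; apply: subgroupN => //; exact: subgroupMn.
Qed.

(** [k] is the order of [a] modulo [U], with 0 standing for infinite order, so that later arguments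
    treat both cases alike. *)
Lemma subgroup_order (A : zmodType) (U : set A) a : subgroup U ->
  exists k : nat, U (a *+ k) /\ forall n : int, U (a *~ n) -> exists q : int, n = q * k%:Z.
Proof.
move=> sU.
have [[k0 k0P]|no] := pselect (exists k, (0 < k)%N && `[< U (a *+ k) >]).
  pose ex := ex_intro (fun k => (0 < k)%N && `[< U (a *+ k) >]) k0 k0P.
  case: (ex_minnP ex) => k /andP[k_gt0 /asboolP Uk] min.
  exists k; split=> // n Un; exists (n %/ k)%Z.
  have : U (a *~ (n %% k)%Z).
    by rewrite /modz mulrzBr mulrC mulrzA; apply: sU.2 => //; exact: subgroupMz.
  have : (0 <= (n %% k)%Z < k)%R by rewrite modz_ge0 ?ltz_pmod //; lia.
  have := divz_eq n k; case: (n %% k)%Z => // -[|r]; first by rewrite addr0.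
  move=> _ /andP[_ rk] Ur; have /min : (0 < r.+1)%N && `[< U (a *+ r.+1) >].
    by apply/asboolP.
  lia.
exists 0%N; split=> [|n Un]; first exact: sU.1.
exists 0; rewrite mulr0; case: n Un => [[|n]|n] // Un; case: no; exists n.+1.
  exact/asboolP.
by apply/asboolP; rewrite -[_ *+ _]opprK; apply: subgroupN => //; rewrite NegzE mulrNz in Un.
Qed.

(** A partial homomorphism kept as a total function, in the format of [partial_extension]; off [S]
    its values are arbitrary. *)
Definition additive_on (A E : zmodType) (S : set A) (f : A -> E) : Prop :=
  subgroup S /\ forall x y, S x -> S y -> f (x - y) = f x - f y.

Lemma additive_on0 (A E : zmodType) (S : set A) (f : A -> E) :
  additive_on S f -> f 0 = 0.
Proof. by move=> [[S0 _] fB]; rewrite -[0 in LHS](subrr 0) fB ?subrr. Qed.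

Lemma additive_onMz (A E : zmodType) (S : set A) (f : A -> E) x (n : int) :
  additive_on S f -> S x -> f (x *~ n) = f x *~ n.
Proof.
move=> [sS fB] Sx.
have f0 := additive_on0 (conj sS fB).
have fN z : S z -> f (- z) = - f z.
  by move=> Sz; rewrite -sub0r fB ?f0 ?sub0r //; exact: sS.1.
have fMn (m : nat) : f (x *+ m) = f x *+ m.
  elim: m => [|m IH]; first by rewrite !mulr0n.
  have -> : x *+ m.+1 = x *+ m - - x by rewrite opprK mulrSr.
  rewrite fB ?IH ?fN ?opprK ?mulrSr //; last exact: subgroupN.
  exact: subgroupMn.
case: n => n; first exact: fMn.
rewrite NegzE !mulrNz fN; last exact: subgroupMz.
by congr (- _); exact: fMn.
Qed.

(** The extension to [S + Za] sends [x] to [f (x - na) + ny]; two admissible integers [n] give the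
    same value by the compatibility hypothesis. *)
Lemma additive_on_extend1 (A E : zmodType) (S : set A) (f : A -> E) a y :
    additive_on S f -> (forall n : int, S (a *~ n) -> f (a *~ n) = y *~ n) ->
  exists S' f', [/\ additive_on S' f', S `<=` S', S' a, f' a = y
                  & {in S, f' =1 f}].
Proof.
move=> [sS fB] fy.
have f0 := additive_on0 (conj sS fB).
have /choice[f' f'P] x : exists z, forall n : int,
    S (x - a *~ n) -> z = f (x - a *~ n) + y *~ n.
  have [[n Sn]|no] := pselect (exists n : int, S (x - a *~ n)); last first.
    by exists 0 => n Sn; case: no; exists n.
  exists (f (x - a *~ n) + y *~ n) => m Sm.
  have mn : x - a *~ n - (x - a *~ m) = a *~ (m - n).
    by rewrite mulrzBr opprB addrC addrA subrK.
  apply/eqP; rewrite -subr_eq0 opprD addrACA -fB // mn fy; last first.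
    by rewrite -mn; exact: sS.2.
  by rewrite -mulrzBr -mulrzDr -opprB addNr.
have f'S x : S x -> f' x = f x.
  by move=> Sx; rewrite (f'P x 0) mulr0z ?subr0 ?addr0.
have subE x z (n m : int) :
    x - z - a *~ (n - m) = (x - a *~ n) - (z - a *~ m).
  by rewrite mulrzBr !opprD !opprK addrACA.
pose S' x := exists n : int, S (x - a *~ n).
exists S', f'; split.
- split; first split.
  + by exists 0; rewrite mulr0z subr0; exact: sS.1.
  + by move=> x z [n Sn] [m Sm]; exists (n - m); rewrite subE; exact: sS.2.
  + move=> x z [n Sn] [m Sm]; rewrite (f'P _ (n - m)) subE; last exact: sS.2.
    by rewrite fB // (f'P x n) // (f'P z m) // mulrzBr opprD addrACA.
- by move=> x Sx; exists 0; rewrite mulr0z subr0.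
- by exists 1; rewrite mulr1z subrr; exact: sS.1.
- by rewrite (f'P a 1) mulr1z ?subrr ?f0 ?add0r //; exact: sS.1.
- by move=> x /set_mem; exact: f'S.
Qed.

(** Baer's argument: a maximal extension is total, because divisibility always supplies a compatible
    value at one more element. *)
Lemma additive_extension (A E : zmodType) (S : set A) (f : A -> E) :
  divisible_group E -> additive_on S f ->
  exists g : {additive A -> E}, {in S, g =1 f}.
Proof.
move=> divE fS.
have [C g [c1 Cc1] addC tot agree|S1 f1 a [sS fB]|//|g [[_ gB] gf]] :=
    @partial_extension _ _ (@additive_on A E) S f.
- have gE c x : C c -> c.1 x -> g x = c.2 x by move=> Cc cx; apply/agree/mem_set.
  have pair x y : (\bigcup_(c in C) c.1) x -> (\bigcup_(c in C) c.1) y ->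
      exists c, [/\ C c, c.1 x & c.1 y].
    move=> [c Cc cx] [c' Cc' c'y].
    by have [/(_ _ cx)|/(_ _ c'y)] := tot _ _ Cc Cc'; [exists c'|exists c].
  split; first split.
  + by exists c1 => //; exact: (addC _ Cc1).1.1.
  + move=> x y /pair xS /xS[c [Cc cx cy]]; exists c => //.
    exact: (addC _ Cc).1.2.
  + move=> x y /pair xS /xS[c [Cc cx cy]].
    by rewrite !(gE c) //; [exact: (addC _ Cc).2|exact: (addC _ Cc).1.2].
- have [k [Sk kP]] := subgroup_order a sS.
  (* If no positive multiple of [a] lies in [S1], then [k = 0] and the value at [a] is free; 0 is
     chosen. *)
  have [y yk] : exists y, y *+ k = f1 (a *+ k).
    have [->|/divE] := posnP k; last exact.
    by exists 0; rewrite !mulr0n (additive_on0 (conj sS fB)).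
  have [||S' [f' [fS' SS' S'a _ eqf]]] := @additive_on_extend1 _ _ S1 f1 a y.
  + by split.
  + move=> n /kP[q ->]; rewrite [q * _]mulrC !mulrzA -[y *~ k]/(y *+ k) yk.
    by rewrite -[a *~ k]/(a *+ k) (additive_onMz _ (conj sS fB)).
  by exists S', f'.
- pose gadd := GRing.isZmodMorphism.Build _ _ g (fun x y => gB x y I I).
  by exists (HB.pack g gadd : {additive A -> E}).
Qed.

(** The zero character on [U] extends to [a] by a non-zero value killed by the order of [a] modulo
    [U], and then to all of [A] by divisibility. *)
Lemma separating_character (A E : zmodType) (U : set A) a :
  divisible_group E -> has_torsion E -> subgroup U -> ~ U a ->
  exists g : {additive A -> E}, (forall x, U x -> g x = 0) /\ g a <> 0.
Proof.
move=> divE torE sU nUa.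
have [k [Uk kP]] := subgroup_order a sU.
have [|y y0 yk] := torE k; first by apply/eqP => k1; rewrite k1 in Uk.
have [||S' [f' [fS' US' S'a f'a eqf]]] := @additive_on_extend1 _ E U (fun=> 0) a y.
- by split=> // *; rewrite subr0.
- by move=> n /kP[q ->]; rewrite mulrC mulrzA -[y *~ k]/(y *+ k) yk mul0rz.
have [g gE] := additive_extension divE fS'.
exists g; split=> [x Ux|]; first by rewrite gE ?eqf //; apply/mem_set => //; exact: US'.
by rewrite gE ?f'a; [exact/eqP|exact/mem_set].
Qed.

(** * Modules *)

Lemma exists_linear (S : pzRingType) (A B : lmodType S) (f : A -> B) :
  linear f -> exists g : {linear A -> B}, g =1 f.
Proof.
move=> f_lin; pose fL := GRing.isLinear.Build S A B *:%R f f_lin.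
by exists (HB.pack f fL : {linear A -> B}).
Qed.

Lemma exists_additive (A B : zmodType) (f : A -> B) :
  zmod_morphism f -> exists g : {additive A -> B}, g =1 f.
Proof.
move=> fB; pose fM := GRing.isZmodMorphism.Build A B f fB.
by exists (HB.pack f fM : {additive A -> B}).
Qed.

Section QuotientModule.
Variables (S : pzRingType) (M : lmodType S) (U : zmodClosed M).
Hypothesis UZ : forall a x, x \in U -> a *: x \in U.

(** The closure proof is a parameter of the type, so that the module structure can depend on it. *)
Definition quotient_module of (forall a x, x \in U -> a *: x \in U) : Type :=
  Quotient.quot U.

Local Notation MU := (quotient_module UZ).

HB.instance Definition _ := GRing.Zmodule.on MU.

Local Notation proj := (\pi_(Quotient.quot U) : M -> MU).

Definition quotient_scale (a : S) (q : MU) : MU :=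
  proj (a *: repr (q : Quotient.quot U)).

Lemma quotient_projP x y : (x - y \in U) = (proj x == proj y).
Proof. exact: Quotient.idealrBE. Qed.

Lemma quotient_reprK (q : MU) : proj (repr (q : Quotient.quot U)) = q.
Proof. exact: reprK. Qed.

Lemma quotient_projD : {morph proj : x y / x + y}.
Proof. exact: raddfD. Qed.

Lemma quotient_scaleE a x : quotient_scale a (proj x) = proj (a *: x).
Proof.
apply/eqP; rewrite -quotient_projP -scalerBr UZ // quotient_projP.
by rewrite quotient_reprK.
Qed.

Fact quotient_scaleA a b q :
  quotient_scale a (quotient_scale b q) = quotient_scale (a * b) q.
Proof. by rewrite [quotient_scale b q]/quotient_scale quotient_scaleE scalerA. Qed.

Fact quotient_scale1 : left_id 1 quotient_scale.
Proof. by move=> q; rewrite /quotient_scale scale1r quotient_reprK. Qed.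

Fact quotient_scaleDr : right_distributive quotient_scale +%R.
Proof.
move=> a q r; rewrite -(quotient_reprK q) -(quotient_reprK r) -quotient_projD.
by rewrite !quotient_scaleE scalerDr quotient_projD.
Qed.

Fact quotient_scaleDl q : {morph quotient_scale^~ q : a b / a + b}.
Proof. by move=> a b; rewrite /quotient_scale scalerDl quotient_projD. Qed.

HB.instance Definition _ := GRing.Zmodule_isLmodule.Build S MU
  quotient_scaleA quotient_scale1 quotient_scaleDr quotient_scaleDl.

End QuotientModule.

Lemma exists_quotient_module (S : pzRingType) (M : lmodType S) (U : set M) :
    U 0 -> (forall a x y, U x -> U y -> U (a *: x + y)) ->
  exists (Q : lmodType S) (p : {linear M -> Q}),
    surjective_fun p /\ forall x, p x = 0 <-> U x.
Proof.
move=> U0 Ulin; pose P : {pred M} := fun x => `[< U x >].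
have Pcl : zmod_closed P.
  split=> [|x y /asboolP Ux /asboolP Uy]; first exact/asboolP.
  by apply/asboolP; rewrite addrC -scaleN1r; exact: Ulin.
pose Ps : zmodClosed M := HB.pack P (GRing.isZmodClosed.Build M P Pcl).
have PZ a x : x \in Ps -> a *: x \in Ps.
  by move=> /asboolP Ux; apply/asboolP; rewrite -[_ *: _]addr0; exact: Ulin.
pose proj (x : M) : quotient_module PZ := \pi_(Quotient.quot Ps) x.
have [|p pE] := @exists_linear S M (quotient_module PZ) proj.
  by move=> a x y; rewrite /proj quotient_projD -quotient_scaleE.
exists (quotient_module PZ), p; split=> [q|x].
  by exists (repr (q : Quotient.quot Ps)); rewrite pE; exact: reprK.
have proj0 : proj 0 = 0 by exact: raddf0.
rewrite pE -proj0; split=> [/eqP|Ux].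
  by rewrite -quotient_projP subr0 => /asboolP.
by apply/eqP; rewrite -quotient_projP subr0; apply/asboolP.
Qed.

Lemma eq_sum_support (X : eqType) (V : nmodType) (g : X -> V) (s t : seq X) :
    uniq s -> uniq t ->
    (forall x, x \notin s -> g x = 0) -> (forall x, x \notin t -> g x = 0) ->
  \sum_(x <- s) g x = \sum_(x <- t) g x.
Proof.
move=> us ut gs gt.
have key r : \sum_(x <- r) g x = \sum_(x <- [seq x <- r | g x != 0]) g x.
  by rewrite big_filter [LHS](bigID (fun x => g x == 0)) /= big1 ?add0r // => x /eqP.
rewrite key [RHS]key; apply: perm_big; apply: uniq_perm; rewrite ?filter_uniq //.
move=> x; rewrite !mem_filter /=; have [//|gx] := eqVneq (g x) 0.
have -> : x \in s by apply: contra_neqT gx; exact: gs.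
by apply/esym; apply: contra_neqT gx; exact: gt.
Qed.

(** * Free modules and dual bases of projective modules *)

Section FreeModule.
Variables (S : pzRingType) (X : choiceType).

Definition finitely_supported : {pred X -> S^o} :=
  fun f => `[< exists s : seq X, forall x, x \notin s -> f x = 0 >].

Fact finitely_supported_closed : submod_closed finitely_supported.
Proof.
split; first by apply/asboolP; exists [::].
move=> a f g /asboolP[s fs] /asboolP[t gt]; apply/asboolP.
exists (s ++ t) => x; rewrite mem_cat negb_or => /andP[/fs fx /gt gx].
by rewrite !fctE fx gx scaler0 addr0.
Qed.

HB.instance Definition _ :=
  GRing.isSubmodClosed.Build S (X -> S^o) finitely_supported
    finitely_supported_closed.

Record free_module := FreeModule {
  coeffs :> X -> S^o;
  _ : coeffs \in finitely_supported
}.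

HB.instance Definition _ := [isSub for coeffs].
HB.instance Definition _ := [Choice of free_module by <:].
HB.instance Definition _ := [SubChoice_isSubLmodule of free_module by <:].

Lemma free_module_support (f : free_module) :
  exists s : seq X, uniq s /\ forall x, x \notin s -> f x = 0.
Proof.
have /asboolP[s fs] := valP f; exists (undup s); split; first exact: undup_uniq.
by move=> x; rewrite mem_undup; exact: fs.
Qed.

End FreeModule.

(** All elements of [P] serve as generators: evaluation maps the free module on the set [P] onto
    [P], projectivity splits it, and the coordinates of the section are the functionals [phi y]. *)
Lemma dual_basis (S : pzRingType) (P : lmodType S) : projective P ->
  exists (phi : P -> P -> S) (s : P -> seq P),
    [/\ forall y, linear (phi y : P -> S^o),
        forall p, uniq (s p),
        forall p y, y \notin s p -> phi y p = 0
      & forall p, p = \sum_(y <- s p) phi y p *: y].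
Proof.
move=> projP.
have /choice[supp suppP] := @free_module_support S P.
pose eval (f : free_module S P) : P := \sum_(x <- supp f) (f x : S) *: x.
have evalE (f : free_module S P) s : uniq s -> (forall x, x \notin s -> f x = 0) ->
    eval f = \sum_(x <- s) (f x : S) *: x.
  move=> us fs; have [u0 f0] := suppP f.
  have fx0 x : f x = 0 -> (f x : S) *: x = 0.
    by move=> fx; rewrite [f x]fx; exact: scale0r.
  by apply: eq_sum_support => // x xs; apply: fx0; [exact: f0|exact: fs].
have [|ev evE] := @exists_linear S (free_module S P) P eval.
  move=> a f g; pose t := undup (supp f ++ supp g).
  have ut : uniq t by exact: undup_uniq.
  have fgE x : coeffs (a *: f + g) x = a * f x + g x by [].
  have [ft gt] : (forall x, x \notin t -> f x = 0) /\ (forall x, x \notin t -> g x = 0).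
    by split=> x; rewrite mem_undup mem_cat negb_or => /andP[];
      [move=> /(suppP f).2|move=> _ /(suppP g).2].
  rewrite !(evalE _ t) // => [|x xt].
    rewrite scaler_sumr -big_split; apply: eq_bigr => x _.
    by rewrite fgE scalerDl scalerA.
  by rewrite fgE (ft x xt) (gt x xt) [a * 0]mulr0 addr0.
have [y|sec secK] := projP _ _ ev idfun.
  have dP : (fun x : P => (x == y)%:R : S^o) \in @finitely_supported S P.
    by apply/asboolP; exists [:: y] => x; rewrite inE => /negPf ->.
  exists (FreeModule dP); rewrite evE (evalE _ [:: y]) //= => [|x].
    by rewrite big_seq1 eqxx scale1r.
  by rewrite inE => /negPf ->.
exists (fun y p => sec p y), (fun p => supp (sec p)); split=> [y a p q|p|p y|p].
- by rewrite linearP.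
- exact: (suppP _).1.
- exact: (suppP _).2.
- by apply: etrans (esym (secK p)) _; rewrite evE.
Qed.

(** * Products and injective character modules *)

Section DependentProduct.
Variables (S : pzRingType) (J : Type) (M : J -> lmodType S).

Definition dprod : Type := forall j, M j.

HB.instance Definition _ := gen_eqMixin dprod.
HB.instance Definition _ := gen_choiceMixin dprod.

Implicit Types f g h : dprod.

Let zero : dprod := fun=> 0.
Let opp f : dprod := fun j => - f j.
Let add f g : dprod := fun j => f j + g j.
Let scale (a : S) f : dprod := fun j => a *: f j.

Fact dprod_addA : associative add.
Proof. by move=> f g h; apply: functional_extensionality_dep => j; exact: addrA. Qed.

Fact dprod_addC : commutative add.
Proof. by move=> f g; apply: functional_extensionality_dep => j; exact: addrC. Qed.

Fact dprod_add0 : left_id zero add.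
Proof. by move=> f; apply: functional_extensionality_dep => j; exact: add0r. Qed.

Fact dprod_addN : left_inverse zero opp add.
Proof. by move=> f; apply: functional_extensionality_dep => j; exact: addNr. Qed.

HB.instance Definition _ :=
  GRing.isZmodule.Build dprod dprod_addA dprod_addC dprod_add0 dprod_addN.

Fact dprod_scaleA a b f : scale a (scale b f) = scale (a * b) f.
Proof. by apply: functional_extensionality_dep => j; exact: scalerA. Qed.

Fact dprod_scale1 : left_id 1 scale.
Proof. by move=> f; apply: functional_extensionality_dep => j; exact: scale1r. Qed.

Fact dprod_scaleDr : right_distributive scale +%R.
Proof.
by move=> a f g; apply: functional_extensionality_dep => j; exact: scalerDr.
Qed.

Fact dprod_scaleDl f : {morph scale^~ f : a b / a + b}.
Proof.
by move=> a b; apply: functional_extensionality_dep => j; exact: scalerDl.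
Qed.

HB.instance Definition _ := GRing.Zmodule_isLmodule.Build S dprod
  dprod_scaleA dprod_scale1 dprod_scaleDr dprod_scaleDl.

End DependentProduct.

Section CharacterModule.
Variables (R : pzRingType) (E : zmodType) (J : Type).

(** The module built on it is the [J]-th power of the group of additive maps from [R] to [E];
    scalars act by right multiplication on the argument, which gives a left module. *)
Definition character_family : {pred J -> R -> E} :=
  fun f => `[< forall j, zmod_morphism (f j) >].

Fact character_family_closed : zmod_closed character_family.
Proof.
split=> [|f g /asboolP fB /asboolP gB]; apply/asboolP => j x y.
  by rewrite subr0.
by rewrite !fctE fB gB !opprD !opprK addrACA.
Qed.

HB.instance Definition _ :=
  GRing.isZmodClosed.Build (J -> R -> E) character_family character_family_closed.

Record character_module := CharacterModule {
  characters :> J -> R -> E;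
  _ : characters \in character_family
}.

HB.instance Definition _ := [isSub for characters].
HB.instance Definition _ := [Choice of character_module by <:].
HB.instance Definition _ := [SubChoice_isSubZmodule of character_module by <:].

Lemma charactersB (f : character_module) j : zmod_morphism (f j).
Proof. by have /asboolP := valP f. Qed.

Lemma charactersD (f : character_module) j x y : f j (x + y) = f j x + f j y.
Proof.
have f0 : f j 0 = 0 by rewrite -[0 in LHS](subrr 0) charactersB subrr.
by rewrite -[y in LHS]opprK -[- y]sub0r !charactersB f0 sub0r opprK.
Qed.

Lemma charactersP (f g : character_module) : (forall j, f j =1 g j) -> f = g.
Proof.
by move=> fg; apply/val_inj/funext => j; apply/funext => x; exact: fg.
Qed.

Fact character_scale_subproof (a : R) (f : character_module) :
  (fun j x => f j (x * a)) \in character_family.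
Proof. by apply/asboolP => j x y; rewrite mulrBl charactersB. Qed.

Definition character_scale a f := CharacterModule (character_scale_subproof a f).

Fact character_scaleA a b f :
  character_scale a (character_scale b f) = character_scale (a * b) f.
Proof. by apply: charactersP => j x /=; rewrite mulrA. Qed.

Fact character_scale1 : left_id 1 character_scale.
Proof. by move=> f; apply: charactersP => j x /=; rewrite mulr1. Qed.

Fact character_scaleDr : right_distributive character_scale +%R.
Proof. by move=> a f g; apply: charactersP. Qed.

Fact character_scaleDl f : {morph character_scale^~ f : a b / a + b}.
Proof. by move=> a b; apply: charactersP => j x /=; rewrite mulrDr charactersD. Qed.

HB.instance Definition _ := GRing.Zmodule_isLmodule.Build R character_module
  character_scaleA character_scale1 character_scaleDr character_scaleDl.

Lemma characterZE (a : R) (f : character_module) j x : (a *: f) j x = f j (x * a).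
Proof. by []. Qed.

Lemma character_sumE (I : Type) (r : seq I) (F : I -> character_module) j x :
  (\sum_(i <- r) F i) j x = \sum_(i <- r) F i j x.
Proof. by elim/big_rec2: _ => // i _ y _ <-. Qed.

(** By adjunction, a linear map into a factor amounts to the additive map obtained by evaluating at
    1. The latter extends along [i] by divisibility, and [x -> g j (x *: b)] recovers the linear
    map. *)
Lemma character_module_injective : divisible_group E ->
  injective_module character_module.
Proof.
move=> divE A B i f i_inj.
have /choice[g gi] j : exists g : {additive B -> E}, forall a, g (i a) = f a j 1.
  have /choice[f0 f0P] b : exists y, forall a, i a = b -> y = f a j 1.
    have [[a <-]|no] := pselect (exists a, i a = b); last first.
      by exists 0 => a ab; case: no; exists a.
    by exists (f a j 1) => a' /i_inj ->.
  have [|g gf0] := @additive_extension B E (range i) f0 divE.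
    split; first split.
    - by exists 0; rewrite ?raddf0.
    - by move=> _ _ [a _ <-] [a' _ <-]; exists (a - a'); rewrite ?raddfB.
    move=> _ _ [a _ <-] [a' _ <-]; rewrite -raddfB /=.
    by rewrite !(f0P _ _ erefl) raddfB.
  by exists g => a; rewrite gf0 ?(f0P _ _ erefl) //; apply/mem_set; exists a.
have gchar b : (fun j x => g j (x *: b)) \in character_family.
  by apply/asboolP => j x y; rewrite scalerBl raddfB.
have [|h hE] := @exists_linear R B character_module (fun b => CharacterModule (gchar b)).
  move=> a b b'; apply: charactersP => j x.
  by rewrite [LHS]/= scalerDr raddfD /= scalerA.
exists h => a; rewrite hE; apply: charactersP => j x /=.
by rewrite -linearZ gi linearZ characterZE mul1r.
Qed.

End CharacterModule.

(** * Tensor products and pure monomorphisms *)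

Lemma balanced_suml (R : pzRingType) (M : rmodType R) (N : lmodType R)
    (A : zmodType) (b : M -> N -> A) (I : Type) (r : seq I) (F : I -> M) n :
  balanced b -> b (\sum_(i <- r) F i) n = \sum_(i <- r) b (F i) n.
Proof.
move=> bal; apply: (big_morph (b^~ n)) => [x y|]; first exact: balancedDl.
by apply: (addIr (b 0 n)); rewrite -(balancedDl bal) !add0r.
Qed.

Lemma balanced_sumr (R : pzRingType) (M : rmodType R) (N : lmodType R)
    (A : zmodType) (b : M -> N -> A) (I : Type) (r : seq I) m (F : I -> N) :
  balanced b -> b m (\sum_(i <- r) F i) = \sum_(i <- r) b m (F i).
Proof.
move=> bal; apply: (big_morph (b m)) => [x y|]; first exact: balancedDr.
by apply: (addIr (b m 0)); rewrite -(balancedDr bal) !add0r.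
Qed.

Lemma balanced0r (R : pzRingType) (M : rmodType R) (N : lmodType R)
    (A : zmodType) (b : M -> N -> A) m : balanced b -> b m 0 = 0.
Proof. by move=> /(balanced_sumr [::] m (fun i : nat => 0)); rewrite !big_nil. Qed.

Lemma balancedNl (R : pzRingType) (M : rmodType R) (N : lmodType R)
    (A : zmodType) (b : M -> N -> A) m n : balanced b -> b (- m) n = - b m n.
Proof.
move=> bal; apply: (addIr (b m n)); rewrite -(balancedDl bal) !addNr.
by have := balanced_suml [::] (fun i : nat => 0) n bal; rewrite !big_nil.
Qed.

(** The quotient by the sums of elementary tensors kills every [tens m n], so it is zero by the
    uniqueness of [tensor_lift]. *)
Lemma tensor_sum (R : pzRingType) (M : rmodType R) (N : lmodType R)
    (x : tensor M N) :
  exists s : seq (M * N), x = \sum_(p <- s) tens p.1 p.2.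
Proof.
pose U (x : tensor M N) := exists s : seq (M * N), x = \sum_(p <- s) tens p.1 p.2.
have bal := tens_balanced M N.
have [|Q [p [_ p0]]] := @exists_quotient_group (tensor M N) U.
  split=> [|_ _ [s ->] [t ->]]; first by exists [::]; rewrite big_nil.
  exists (s ++ [seq (- q.1, q.2) | q <- t]); rewrite big_cat big_map -sumrN.
  by congr (_ + _); apply: eq_bigr => q _; rewrite balancedNl.
have bal0 : balanced (fun (m : M) (n : N) => 0 : Q) by split=> *; rewrite ?addr0.
have pE : p =1 tensor_lift (fun (m : M) (n : N) => 0 : Q).
  apply: tensor_lift_unique => [//|y z|m n]; first exact: raddfB.
  by apply/p0; exists [:: (m, n)]; rewrite big_seq1.
apply/p0; rewrite pE.
rewrite -(tensor_lift_unique bal0 (g := fun=> 0)) // => y z.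
by rewrite subrr.
Qed.

Lemma tensor_mapB (R : pzRingType) (M M' : rmodType R) (f : {linear M -> M'})
  (N : lmodType R) : zmod_morphism (tensor_map f (N := N)).
Proof.
apply: tensor_lift_is_zmod_morphism; have [bDl bDr bM] := tens_balanced M' N.
by split=> *; rewrite ?linearD ?linearZ ?bDl ?bDr ?bM.
Qed.

Lemma zmod_morphism_sum (A B : zmodType) (f : A -> B) (I : Type) (r : seq I)
  (F : I -> A) : zmod_morphism f -> f (\sum_(i <- r) F i) = \sum_(i <- r) f (F i).
Proof.
by move=> /exists_additive[g gE]; rewrite -gE raddf_sum; apply: eq_bigr.
Qed.

(* A finite linear system over M solvable in L says that an element of
   M (x) N vanishes in L (x) N, where N is presented by the system. *)
Lemma pure_mono_solution (R : pzRingType) (M L : rmodType R) (i : {linear M -> L})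
    (J I : finType) (A : J -> I -> R) (m : J -> M) :
    pure_mono i ->
    (exists w : I -> L, forall j, \sum_l (A j l : R^c) *: w l = i (m j)) ->
  exists w : I -> M, forall j, \sum_l (A j l : R^c) *: w l = m j.
Proof.
move=> [_ pure] [w wE].
pose U (v : J -> R^o) := exists c : I -> R, forall j, v j = \sum_l c l * A j l.
(* [N] has one generator for each equation and one relation for each unknown: it is the quotient by
   the span of the columns of [A]. *)
have [||N [p [p_surj p0]]] := @exists_quotient_module R (J -> R^o) U.
- by exists (fun=> 0) => j; rewrite big1 // => l _; rewrite mul0r.
- move=> a u v [c uE] [c' vE]; exists (fun l => a * c l + c' l) => j.
  rewrite !fctE uE vE scaler_sumr -big_split; apply: eq_bigr => l _ /=.
  by rewrite mulrDl -mulrA.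
pose delta j : J -> R^o := fun j' => (j' == j)%:R.
pose V (u : J -> M) := exists w : I -> M, forall j, u j = \sum_l (A j l : R^c) *: w l.
(* [Q] consists of right-hand sides modulo solvable ones; the balanced map [b] below carries
   [M (x) N] to it. *)
have [|Q [p2 [_ p20]]] := @exists_quotient_group (J -> M) V.
  split=> [|u v [c uE] [c' vE]].
    by exists (fun=> 0) => j; rewrite big1 // => l _; rewrite scaler0.
  exists (fun l => c l - c' l) => j; rewrite !fctE uE vE -sumrB.
  by apply: eq_bigr => l _; rewrite scalerBr.
have /choice[s sK] := p_surj.
pose b (x : M) (q : N) : Q := p2 (fun j => (s q j : R^c) *: x).
have bE x v : b x (p v) = p2 (fun j => (v j : R^c) *: x).
  apply/eqP; rewrite -subr_eq0 /b -raddfB; apply/eqP/p20.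
  have [|c cE] := (p0 (s (p v) - v)).1; first by rewrite raddfB /= sK subrr.
  exists (fun l => (c l : R^c) *: x) => j.
  rewrite !fctE -scalerBl [X in X *: x](cE j) scaler_suml.
  by apply: eq_bigr => l _; rewrite scalerA.
have bal : balanced b.
  split=> [x x' q|x q q'|x r q].
  - rewrite /b -raddfD; congr (p2 _); apply/funext => j.
    by rewrite !fctE scalerDr.
  - rewrite -(sK q) -(sK q') -raddfD !bE -raddfD; congr (p2 _); apply/funext => j.
    by rewrite !fctE scalerDl.
  - rewrite -(sK q) -linearZ !bE; congr (p2 _); apply/funext => j.
    by rewrite scalerA.
have tbal := tens_balanced M N; have tbalL := tens_balanced L N.
(* The image of [x] in [Q] is the class of [m]. In [L] a solution [w] rewrites [x] as a sum of
   tensors of [w l] with the relations of [N], which are zero. *)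
pose x := \sum_j tens (m j) (p (delta j)).
have x0 : x = 0.
  apply: (pure N); rewrite (zmod_morphism_sum _ _ (@tensor_mapB _ _ _ i N)).
  have -> : tensor_map i 0 = 0 :> tensor L N.
    by rewrite -[0 in LHS](subrr 0) tensor_mapB subrr.
  under eq_bigr => j _ do rewrite tensor_mapE -wE (balanced_suml _ _ _ tbalL).
  rewrite exchange_big big1 //= => l _.
  under eq_bigr => j _ do rewrite (balancedM tbalL).
  rewrite -(balanced_sumr _ _ _ tbalL).
  under eq_bigr => j _ do rewrite -linearZ.
  rewrite -linear_sum (p0 _).2 ?(balanced0r _ tbalL) //.
  exists (fun l' => (l' == l)%:R) => j; rewrite fct_sumE.
  rewrite (bigD1 j) //= big1 => [|j' j'j]; last first.
    by rewrite !fctE /delta eq_sym (negPf j'j); exact: scaler0.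
  rewrite (bigD1 l) //= [X in _ = _ + X]big1 => [|l' l'l]; last first.
    by rewrite (negPf l'l) mul0r.
  by rewrite !fctE /delta !eqxx mul1r !addr0; exact: mulr1.
have : tensor_lift b x = 0.
  by rewrite x0 -(subrr 0) (tensor_lift_is_zmod_morphism bal) subrr.
rewrite (zmod_morphism_sum _ _ (tensor_lift_is_zmod_morphism bal)).
under eq_bigr => j _ do rewrite (tensor_liftE bal) bE.
rewrite -raddf_sum => /p20[w' w'E]; exists w' => j; rewrite -w'E fct_sumE.
rewrite (bigD1 j) //= big1 ?addr0 => [|j' j'j]; last first.
  by rewrite /delta eq_sym (negPf j'j) scale0r.
by rewrite /delta eqxx scale1r.
Qed.

(** * Closure properties of finite solvability *)

Lemma pi_choice (I : Type) (T : I -> Type) (P : forall i, T i -> Prop) :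
  (forall i, exists x, P i x) -> exists f : forall i, T i, forall i, P i (f i).
Proof.
by move=> ex; exists (fun i => sval (cid (ex i))) => i; exact: svalP (cid (ex i)).
Qed.

Section DirectLimit.
Variables (S : pzRingType) (disp : Order.disp_t) (I : porderType disp).
Variables (M : I -> lmodType S) (phi : forall i j, (i <= j)%O -> {linear M i -> M j}).
Variables (L : lmodType S) (psi : forall i, {linear M i -> L}).
Hypotheses (dirI : directed I) (sysM : direct_system phi)
  (limL : is_direct_limit phi psi).

(** The union of the images is a submodule by directedness. The projection modulo it and the zero
    map agree on every stage, hence are equal by the universal property. *)
Lemma direct_limit_surj l : exists i (x : M i), psi i x = l.
Proof.
have [[i0] upper] := dirI; have [coc univ] := limL.
pose U l := exists i (x : M i), psi i x = l.
have [||Q [p [_ p0]]] := @exists_quotient_module S L U.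
- by exists i0, 0; rewrite raddf0.
- move=> a _ _ [i [x <-]] [j [y <-]]; have [k [ik jk]] := upper i j.
  exists k, (a *: phi ik x + phi jk y).
  by rewrite linearP; congr (a *: _ + _); [exact: coc|exact: coc].
have [zero zeroE] : exists z : {linear L -> Q}, forall l, z l = 0.
  by apply: exists_linear => a x y; rewrite scaler0 addr0.
have /pi_choice[q qE] i : exists q : {linear M i -> Q}, forall x, q x = 0.
  by apply: exists_linear => a x y; rewrite scaler0 addr0.
have [|f [_ uniq_f]] := univ Q q; first by move=> i j ij x /=; rewrite !qE.
apply/p0; rewrite (uniq_f p) => [|i x].
  by rewrite -(uniq_f zero) ?zeroE // => i x; rewrite zeroE qE.
by rewrite qE; apply/p0; exists i, x.
Qed.

(* The cocone of the truncated families (phi_ij x)_(j >= i), modulo families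
   that vanish eventually, detects the elements that survive in the limit. *)
Lemma direct_limit_ker i (x : M i) : psi i x = 0 ->
  exists j (ij : (i <= j)%O), phi ij x = 0.
Proof.
have [[i0] upper] := dirI; have [coc univ] := limL; have [phi1 phiM] := sysM.
pose U (f : dprod M) := exists k, forall j, (k <= j)%O -> f j = 0.
have [||Q [p [_ p0]]] := @exists_quotient_module S (dprod M) U.
- by exists i0.
- move=> a f g [k fk] [l gl]; have [m [km lm]] := upper k l; exists m => j mj.
  transitivity (a *: f j + g j) => //.
  by rewrite fk ?gl ?scaler0 ?addr0 //; exact: le_trans mj.
pose ext i (x : M i) : dprod M :=
  fun j => if @idP (i <= j)%O is ReflectT ij then phi ij x else 0.
have extE k (y : M k) j (kj : (k <= j)%O) : ext k y j = phi kj y.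
  rewrite /ext; case: {-}_ / idP => [kj'|/(_ kj)//].
  by rewrite (bool_irrelevance kj' kj).
have extnE k (y : M k) j : ~ (k <= j)%O -> ext k y j = 0.
  by rewrite /ext; case: {-}_ / idP.
have /pi_choice[q qE] k : exists q : {linear M k -> Q}, forall y, q y = p (ext k y).
  apply: exists_linear => a y z; rewrite -linearP; congr (p _).
  apply: functional_extensionality_dep => j; transitivity (a *: ext k y j + ext k z j) => //.
  have [kj|nkj] := pselect (k <= j)%O; first by rewrite !extE linearP.
  by rewrite !extnE // scaler0 addr0.
have [j k jk y|f [fE _]] := univ Q q.
  rewrite /= !qE; apply/eqP; rewrite -subr_eq0 -raddfB; apply/eqP/p0.
  exists k => l kl; transitivity (ext k (phi jk y) l - ext j y l) => //.
  by rewrite !extE ?(le_trans jk kl) // => jl; rewrite -(phiM _ _ _ jk kl jl) subrr.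
move=> psi0; have /p0[k kP] : p (ext i x) = 0 by rewrite -qE -fE psi0 raddf0.
have [j [ij kj]] := upper i k; exists j, ij.
by rewrite -(extE _ _ _ ij) kP.
Qed.

Lemma direct_limit_lift (X : eqType) (T : seq X) (h : X -> L) :
  exists i (h' : X -> M i), {in T, forall x, psi i (h' x) = h x}.
Proof.
have [[i0] upper] := dirI; have [coc univ] := limL.
elim: T => [|x T [i [h' h'E]]]; first by exists i0, (fun=> 0).
have [j [y yE]] := direct_limit_surj (h x); have [k [ik jk]] := upper i j.
exists k, (fun z => if z == x then phi jk y else phi ik (h' z)) => z.
rewrite inE; case: eqVneq => [-> _|_ /= zT]; first by rewrite -yE; exact: coc.
by rewrite -h'E //; exact: coc.
Qed.

Lemma direct_limit_kill (X : eqType) (T : seq X) i (h : X -> M i) :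
    {in T, forall x, psi i (h x) = 0} ->
  exists j (ij : (i <= j)%O), {in T, forall x, phi ij (h x) = 0}.
Proof.
have [_ upper] := dirI; have [phi1 phiM] := sysM.
elim: T => [|x T IH] hT; first by exists i, (lexx i).
have [|j [ij hj]] := IH; first by move=> y yT; apply: hT; rewrite inE yT orbT.
have [|k [ik xk]] := @direct_limit_ker i (h x); first by apply: hT; exact: mem_head.
have [l [jl kl]] := upper j k; have il := le_trans ij jl; exists l, il => y.
rewrite inE => /predU1P[->|yT].
  by rewrite -(phiM _ _ _ ik kl il) /= xk raddf0.
by rewrite -(phiM _ _ _ ij jl il) /= hj // raddf0.
Qed.

End DirectLimit.

(** * Row-finite systems over varying modules *)

Section RowFinite.
Variables (S : pzRingType) (X : eqType).

(** A row-finite matrix: [s x] lists the columns read in row [x], and entries elsewhere are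
    ignored. *)
Definition row_op (s : X -> seq X) (a : X -> X -> S) (D : lmodType S)
    (h : X -> D) : X -> D :=
  fun x => \sum_(y <- s x) a x y *: h y.

Lemma row_op_local s a (D : lmodType S) (h h' : X -> D) x :
  {in s x, h =1 h'} -> row_op s a h x = row_op s a h' x.
Proof. by move=> hh'; apply: eq_big_seq => y /hh' ->. Qed.

Lemma row_op_linear s a (D D' : lmodType S) (f : {linear D -> D'}) (h : X -> D) x :
  row_op s a (f \o h) x = f (row_op s a h x).
Proof. by rewrite linear_sum; apply: eq_bigr => y _; rewrite linearZ. Qed.

Lemma row_op_is_zmod_morphism s a (D : lmodType S) : zmod_morphism (@row_op s a D).
Proof.
move=> h h'; apply/funext => x; transitivity (row_op s a h x - row_op s a h' x) => //.
rewrite /row_op -sumrB.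
by apply: eq_bigr => y _; rewrite !fctE scalerBr.
Qed.

HB.instance Definition _ s a (D : lmodType S) :=
  GRing.isZmodMorphism.Build (X -> D) (X -> D) (@row_op s a D)
    (@row_op_is_zmod_morphism s a D).

Variables (sd se : X -> seq X) (d e : X -> X -> S).

Definition solvable_over (D : lmodType S) (F G : seq X) : Prop :=
  forall h : X -> D, {in G, forall x, row_op sd d h x = 0} ->
  exists w : X -> D, {in F, row_op sd d w =1 row_op se e h}.

(** Solutions in the factors are assembled pointwise. Elements of [L] are handled as maps out of
    [S^o], to which the universal property applies. *)
Lemma solvable_over_product (I : Type) (M : I -> lmodType S) (L : lmodType S)
    (p : forall i, {linear L -> M i}) F G :
  is_product p -> (forall i, solvable_over (M i) F G) -> solvable_over L F G.
Proof.
move=> prodL solM h dh.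
have p_inj l l' : (forall i, p i l = p i l') -> l = l'.
  move=> ll'.
  have /exists_linear[f fE] : linear (fun a : S^o => a *: l).
    by move=> a x y; rewrite scalerDl scalerA.
  have /exists_linear[f' f'E] : linear (fun a : S^o => a *: l').
    by move=> a x y; rewrite scalerDl scalerA.
  have /pi_choice[q qE] i : exists q : {linear S^o -> M i}, forall x, q x = p i (f x).
    by apply: exists_linear => a x y; rewrite !linearP.
  have [g [_ uniq_g]] := prodL S^o q.
  have := uniq_g f' _ 1; rewrite f'E scale1r => ->; last first.
    by move=> i x; rewrite qE f'E fE !linearZ ll'.
  have := uniq_g f _ 1; rewrite fE scale1r => -> //.
have p_fam (m : forall i, M i) : exists l, forall i, p i l = m i.
  have /pi_choice[q qE] i : exists q : {linear S^o -> M i}, forall x : S, q x = x *: m i.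
    by apply: exists_linear => a x y; rewrite scalerDl scalerA.
  have [g [gE _]] := prodL S^o q.
  by exists (g 1) => i; rewrite gE qE scale1r.
have /pi_choice[w wE] i : exists w, {in F, row_op sd d w =1 row_op se e (p i \o h)}.
  by apply: solM => x xG; rewrite row_op_linear dh ?raddf0.
have /choice[w' w'E] x := p_fam (fun i => w i x).
exists w' => x xF; apply: p_inj => i; rewrite -!row_op_linear -wE //.
by apply: row_op_local => y _ /=; rewrite w'E.
Qed.

(** Only finitely many values of [h] and finitely many equations matter: the values lift to one
    stage, the equations hold at a later one, and the solution found there is mapped to [L]. *)
Lemma solvable_over_direct_limit (disp : Order.disp_t) (I : porderType disp)
    (M : I -> lmodType S) (phi : forall i j, (i <= j)%O -> {linear M i -> M j})
    (L : lmodType S) (psi : forall i, {linear M i -> L}) F G :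
    directed I -> direct_system phi -> is_direct_limit phi psi ->
  (forall i, solvable_over (M i) F G) -> solvable_over L F G.
Proof.
move=> dirI sysM limL solM h dh.
pose T := flatten (map sd G) ++ flatten (map se F).
have [i [h' h'E]] := direct_limit_lift dirI limL T h.
have [x xG|j [ij h'0]] :=
    direct_limit_kill dirI sysM limL (T := G) (h := row_op sd d h').
  rewrite -row_op_linear -[RHS](dh x xG); apply: row_op_local => y yx.
  by rewrite /= h'E // mem_cat (mem_flatten_map xG yx).
have [x xG|w wE] := solM j (phi _ _ ij \o h').
  by rewrite row_op_linear h'0.
exists (psi j \o w) => x xF; rewrite row_op_linear wE // -row_op_linear.
apply: row_op_local => y yx /=.
by rewrite -h'E ?mem_cat ?(mem_flatten_map xF yx) ?orbT //; exact: limL.1.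
Qed.

End RowFinite.

(** The rows in [F] involve finitely many unknowns, so they form a finite system with right-hand
    side in [M]; its solution in [L] descends by purity. *)
Lemma solvable_over_pure (R : pzRingType) (X : choiceType)
    (sd se : X -> seq X) (d e : X -> X -> R^c) (M L : rmodType R)
    (i : {linear M -> L}) F G :
  pure_mono i -> solvable_over sd se d e L F G -> solvable_over sd se d e M F G.
Proof.
move=> pure solL h dh.
have [x xG|w wE] := solL (i \o h); first by rewrite row_op_linear dh ?raddf0.
pose T := flatten (map sd F).
(* The inner sum collects repeated occurrences of one column in [sd]. *)
pose A (x : seq_sub F) (l : seq_sub T) : R :=
  \sum_(y <- sd (val x) | y == val l) (d (val x) y : R).
have AE (D : rmodType R) (u : X -> D) (x : seq_sub F) :
    row_op sd d u (val x) = \sum_l (A x l : R^c) *: u (val l).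
  rewrite /row_op.
  under [RHS]eq_bigr => l _ do rewrite scaler_suml big_mkcond.
  rewrite exchange_big; apply: eq_big_seq => y yx /=.
  have yT : y \in T by exact: mem_flatten_map (valP x) yx.
  rewrite (bigD1 (SeqSub yT)) //= eqxx big1 ?addr0 // => l lT.
  by rewrite ifN // eq_sym; apply: contraNneq lT => ly; exact/eqP/val_inj.
have [|w' w'E] := @pure_mono_solution R M L i (seq_sub F) (seq_sub T) A
    (fun x => row_op se e h (val x)) pure.
  exists (fun l => w (val l)) => x; rewrite -AE wE ?row_op_linear //.
  exact: valP.
exists (fun y => if insub y is Some l then w' l else 0) => x xF.
rewrite -[x in RHS]/(val (SeqSub xF)) -w'E -[x in LHS]/(val (SeqSub xF)) AE.
by apply: eq_bigr => l _; rewrite valK.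
Qed.

Lemma definable_solvable (R : pzRingType) (X : choiceType)
    (sd se : X -> seq X) (d e : X -> X -> R^c) F G :
  definable (fun D : rmodType R => solvable_over sd se d e D F G).
Proof.
split=> [I M L p|disp I M phi L psi|M L i].
- exact: solvable_over_product.
- exact: solvable_over_direct_limit.
- exact: solvable_over_pure.
Qed.

(** The system is solved separately in each coordinate of a dual basis of [Q]. Finitely many
    coordinates [T] suffice, since [e h] on [F] reads finitely many values of [h]. *)
Lemma solvable_over_projective (S : pzRingType) (X : eqType)
    (sd se : X -> seq X) (d e : X -> X -> S) (Q : lmodType S) F G :
  projective Q -> solvable_over sd se d e S^o F G -> solvable_over sd se d e Q F G.
Proof.
move=> /dual_basis[phi [s [phi_lin uniq_s phi0 phiE]]] solS h dh.
have /choice[f fE] y := exists_linear (phi_lin y).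
have /choice[w wE] y : exists w : X -> S^o,
    {in F, row_op sd d w =1 row_op se e (f y \o h)}.
  by apply: solS => x xG; rewrite row_op_linear dh ?raddf0.
pose T := undup (flatten [seq s (h z) | z <- flatten (map se F)]).
exists (fun x => \sum_(y <- T) (w y x : S) *: y) => x xF.
have hE z : z \in se x -> h z = \sum_(y <- T) (f y (h z) : S) *: y.
  move=> zx; rewrite [LHS]phiE.
  under [RHS]eq_bigr => y _ do rewrite fE.
  apply: eq_sum_support => [||y /phi0 ->|y yT]; rewrite ?scale0r ?uniq_s ?undup_uniq //.
  rewrite phi0 ?scale0r //; apply: contra yT => yz; rewrite mem_undup.
  exact: mem_flatten_map (mem_flatten_map xF zx) yz.
transitivity (\sum_(y <- T) (row_op se e (f y \o h) x : S) *: y).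
  under [RHS]eq_bigr => y _ do rewrite -wE // /row_op scaler_suml.
  rewrite exchange_big; apply: eq_bigr => z _; rewrite scaler_sumr.
  by apply: eq_bigr => y _; rewrite scalerA.
under eq_bigr => y _ do rewrite /row_op scaler_suml.
rewrite exchange_big; apply: eq_big_seq => z /hE ->; rewrite scaler_sumr.
by apply: eq_bigr => y _; rewrite scalerA.
Qed.

(** * The complex in coordinates *)

Lemma tagged_as_neq (I : eqType) (T : I -> Type) (u v : {i : I & T i}) :
  tag u != tag v -> tagged_as u v = tagged u.
Proof. by rewrite /tagged_as; case: eqP. Qed.

Section Coordinates.
Variables (S : pzRingType) (P : int -> lmodType S).
Variables (d : forall n, {linear P n -> P (n + 1)}).
Variables (phi : forall n, P n -> P n -> S) (s : forall n, P n -> seq (P n)).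
Hypothesis phi_linear : forall n y, linear (phi (n := n) y : P n -> S^o).
Hypothesis uniq_s : forall n (p : P n), uniq (s p).
Hypothesis phi0 : forall n (p y : P n), y \notin s p -> phi y p = 0.
Hypothesis phiE : forall n (p : P n), p = \sum_(y <- s p) phi y p *: y.

Local Notation X := {n : int & P n}.
Local Notation elt p := (@Tagged int _ P p).

Definition shift (x : X) : X := elt (d (tag x) (tagged x)).
Definition supp (x : X) : seq X := [seq elt y | y <- s (tagged x)].
(* A junk value unless x and y have the same degree, as they do for y in
   supp x. *)
Definition coef (x y : X) : S := phi (tagged_as x y) (tagged x).
(** Row [x] of the differential is row [shift x] of the projection: the differential of [h] is the
    linear family [e h] precomposed with [d]. *)
Definition dsupp (x : X) : seq X := supp (shift x).
Definition dcoef (x y : X) : S := coef (shift x) y.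

Section Operators.
Variable D : lmodType S.
Implicit Types h : X -> D.

Local Notation e := (row_op supp coef (D := D)).
Local Notation dd := (row_op dsupp dcoef (D := D)).

(** The functionals make the right side linear in [p], and [phiE] makes it equal to [h] when [h] is
    linear; so [e] projects onto families of linear maps. *)
Lemma coord_opE h n (p : P n) :
  e h (elt p) = \sum_(y <- s p) phi y p *: h (elt y).
Proof.
rewrite /row_op /supp big_map; apply: eq_bigr => y _.
by rewrite /coef tagged_asE.
Qed.

Lemma coord_op_linear h n : linear (fun p : P n => e h (elt p)).
Proof.
move=> a p q; pose T := undup (s (a *: p + q) ++ s p ++ s q).
have sumT (r : P n) : {subset s r <= T} ->
    e h (elt r) = \sum_(y <- T) phi y r *: h (elt y).
  move=> rT; rewrite coord_opE.
  apply: eq_sum_support => [||y /phi0 ->|y yT]; rewrite ?scale0r ?uniq_s ?undup_uniq //.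
  by rewrite phi0 ?scale0r //; apply: contra yT; exact: rT.
rewrite !sumT => [|y yr|y yr|y yr]; rewrite ?mem_undup ?mem_cat ?yr ?orbT //.
rewrite scaler_sumr -big_split; apply: eq_bigr => y _ /=.
by rewrite phi_linear scalerDl scalerA.
Qed.

Lemma coord_op_id h n (p : P n) : linear (fun p : P n => h (elt p)) ->
  e h (elt p) = h (elt p).
Proof.
move=> /exists_linear[g gE]; rewrite coord_opE -gE {3}(phiE p) linear_sum.
by apply: eq_bigr => y _; rewrite linearZ gE.
Qed.

Lemma diff_opE h n (p : P n) : dd h (elt p) = e h (elt (d n p)).
Proof. by []. Qed.

Lemma diff_op_linear h n : linear (fun p : P n => dd h (elt p)).
Proof. by move=> a p q; rewrite !diff_opE linearP coord_op_linear. Qed.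

Lemma coord_op_idem h : e (e h) = e h.
Proof. by apply/funext => -[n p]; apply: coord_op_id; exact: coord_op_linear. Qed.

Lemma coord_diff_op h : e (dd h) = dd h.
Proof. by apply/funext => -[n p]; apply: coord_op_id; exact: diff_op_linear. Qed.

Lemma diff_coord_op h : dd (e h) = dd h.
Proof. by apply/funext => -[n p]; rewrite !diff_opE coord_op_idem. Qed.

Lemma diff_diff_op h : (forall n p, d (n + 1) (d n p) = 0) -> dd (dd h) = 0.
Proof.
move=> dd0; apply/funext => -[n p].
rewrite diff_opE coord_diff_op diff_opE dd0.
by have /exists_linear[g gE] := coord_op_linear h (n := n + 1 + 1); rewrite -gE raddf0.
Qed.

Lemma hom_exact_of_solvable : (forall n p, d (n + 1) (d n p) = 0) ->
    (forall F, exists G, solvable_over dsupp supp dcoef coef D F G) ->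
  forall n, hom_exact D (d n) (d (n + 1)).
Proof.
move=> dd0 solD n h; split; last by move=> [k kE] a; rewrite -kE dd0 raddf0.
move=> hd.
(* H extends h by 0 in the degrees other than n + 1, where tagged_as returns its
   default. *)
pose H (x : X) := h (tagged_as (elt (0 : P (n + 1))) x).
have HE p : H (elt p) = h p by rewrite /H tagged_asE.
have H0 m (p : P m) : n + 1 != m -> H (elt p) = 0.
  by move=> nm; rewrite /H tagged_as_neq // raddf0.
have H_linear m : linear (fun p : P m => H (elt p)).
  have [<-|nm] := eqVneq (n + 1) m => a p q; first by rewrite !HE linearP.
  by rewrite !H0 // scaler0 addr0.
have [w wE] : exists w, dd w = e H.
  apply: (@differential_system_exact X D (row_op dsupp dcoef (D := D))
            (row_op supp coef (D := D)) dsupp supp).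
  - by move=> *; exact: row_op_local.
  - by move=> *; exact: row_op_local.
  - by move=> g; exact: diff_diff_op.
  - exact: coord_op_idem.
  - exact: coord_diff_op.
  - exact: diff_coord_op.
  - exact: solD.
  apply/funext => -[m p]; rewrite [LHS]diff_opE coord_op_id //.
  have [nm|nm] := eqVneq n m; first by case: m / nm p => p; rewrite HE hd.
  by rewrite H0 // (inj_eq (addIr 1)).
(* [w] itself need not be linear; [e w] is, and its composite with [d] is [dd w]. *)
have /exists_linear[k kE] := coord_op_linear w (n := n + 1 + 1).
by exists k => b; rewrite kE -diff_opE wE coord_op_id.
Qed.

Lemma solvable_over_graded :
    (forall n (F : seq (P n)), exists G,
       solvable_over dsupp supp dcoef coef D [seq elt p | p <- F] G) ->
  forall F, exists G, solvable_over dsupp supp dcoef coef D F G.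
Proof.
move=> sol F.
pose part m := [seq tagged_as (elt (0 : P m)) x | x <- F & tag x == m].
have /choice[G GP] m := sol m (part m).
exists (flatten [seq G m | m <- map tag F]) => h dh.
have /choice[W WP] m : exists w, m \in map tag F ->
    {in [seq elt p | p <- part m], dd w =1 e h}.
  have [mF|] := boolP (m \in map tag F); last by exists 0.
  have [|w wE] := GP m h; last by exists w.
  by move=> x xG; apply: dh; exact: mem_flatten_map mF xG.
(* Rows of degree [m] read only values of degree [m + 1], so solutions chosen degree by degree glue
   after a shift by one. *)
exists (fun x => W (tag x - 1) x) => -[m p] pF.
rewrite -(WP m); last 2 first.
- by apply/mapP; exists (elt p).
- apply/map_f/mapP; exists (elt p); last by rewrite tagged_asE.
  by rewrite mem_filter eqxx.
by apply: row_op_local => _ /mapP[y _ ->] /=; rewrite addrK.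
Qed.

End Operators.

End Coordinates.

(** * Finite solvability over the ring itself *)

Section Regular.
Variables (R : pzRingType) (P : int -> rmodType R).
Variables (d : forall n, {linear P n -> P (n + 1)}).
Variables (phi : forall n, P n -> P n -> R^c) (s : forall n, P n -> seq (P n)).
Hypothesis phi_linear : forall n y, linear (phi (n := n) y : P n -> (R^c)^o).
Hypothesis uniq_s : forall n (p : P n), uniq (s p).
Hypothesis phi0 : forall n (p y : P n), y \notin s p -> phi y p = 0.
Hypothesis phiE : forall n (p : P n), p = \sum_(y <- s p) phi y p *: y.
Hypothesis tensor_exact : forall I : lmodType R, injective_module I ->
  forall n, exact (tensor_map (d n) (N := I)) (tensor_map (d (n + 1)) (N := I)).

Local Notation X := {n : int & P n}.
Local Notation elt p := (@Tagged int _ P p).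
Local Notation RR := (regular_rmodule R).
Local Notation e := (row_op (supp s) (coef phi) (D := RR)).
Local Notation dd := (row_op (dsupp d s) (dcoef d phi) (D := RR)).

Lemma solvable_over_regular_graded n (F : seq (P n)) :
  exists G, solvable_over (dsupp d s) (supp s) (dcoef d phi) (coef phi) RR
              [seq elt p | p <- F] G.
Proof.
have [m mE] : exists m : int, m + 1 = n by exists (n - 1); rewrite subrK.
case: n / mE F => F.
apply: contrapT => noG.
have [E [divE torE]] := exists_divisible_torsion.
pose T := seq_sub F.
pose U (v : T -> R) := exists w : X -> RR, forall j : T, v j = dd w (elt (val j)).
have sU : subgroup U.
  split=> [|u v [w uE] [w' vE]].
    by exists 0 => j; rewrite [RHS](_ : _ = 0 (elt (val j))) ?raddf0.
  exists (w - w') => j; rewrite raddfB; transitivity (u j - v j) => //.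
  by rewrite uE vE.
have /choice[h hP] (G : seq X) : exists h : X -> RR,
    {in G, forall x, dd h x = 0} /\ ~ U (fun j => e h (elt (val j))).
  apply: contrapT => noh; apply: noG; exists G => h dh.
  apply: contrapT => now; apply: noh; exists h; split=> // -[w wE].
  by apply: now; exists w => _ /mapP[p pF ->]; rewrite -(wE (SeqSub pF)).
have /choice[chi chiP] G : exists chi : {additive (T -> R) -> E},
    (forall v, U v -> chi v = 0) /\ chi (fun j => e (h G) (elt (val j))) <> 0.
  exact: separating_character (hP G).2.
pose single (j : T) (t : R) : T -> R := fun j' => if j' == j then t else 0.
have singleB j : zmod_morphism (single j).
  move=> t u; apply/funext => j'; transitivity (single j t j' - single j u j') => //.
  by rewrite /single; case: eqP; rewrite ?subr0.
have sum_single (v : T -> R) : \sum_j single j (v j) = v.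
  apply/funext => j; rewrite fct_sumE (bigD1 j) //= /single eqxx big1 ?addr0 //.
  by move=> j' /negPf; rewrite eq_sym => ->.
have iP j : (fun G t => chi G (single j t)) \in @character_family R E (seq X).
  by apply/asboolP => G t u; rewrite singleB raddfB.
(* The index set of the power is the set of all candidates [G]; the component of [i j] at [G] is the
   restriction of [chi G] to the coordinate [j]. *)
pose i j : character_module R E (seq X) := CharacterModule (iP j).
pose xi : tensor (P (m + 1)) (character_module R E (seq X)) :=
  \sum_(j : T) tens (val j) (i j).
have d_xi : tensor_map (d (m + 1)) xi = 0.
  have tbal := tens_balanced (P (m + 1 + 1)) (character_module R E (seq X)).
  pose Y := undup (flatten [seq s (d _ p) | p <- F]).
  have dE (j : T) : d (m + 1) (val j) = \sum_(y <- Y) phi y (d _ (val j)) *: y.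
    rewrite [LHS]phiE.
    apply: eq_sum_support => [||y /phi0 ->|y yY]; rewrite ?scale0r ?uniq_s ?undup_uniq //.
    rewrite phi0 ?scale0r //; apply: contra yY => yj; rewrite mem_undup.
    by apply/flatten_mapP; exists (val j) => //; exact: valP.
  rewrite (zmod_morphism_sum _ _ (@tensor_mapB _ _ _ (d (m + 1)) _)).
  under eq_bigr => j _ do rewrite tensor_mapE dE (balanced_suml _ _ _ tbal).
  rewrite exchange_big big1 //= => y _.
  under eq_bigr => j _ do rewrite (balancedM tbal).
  rewrite -(balanced_sumr _ _ _ tbal).
  rewrite [X in tens _ X](_ : _ = 0) ?(balanced0r _ tbal) //.
  apply: charactersP => G t; rewrite character_sumE.
  under eq_bigr => j _ do rewrite characterZE /=.
  rewrite -raddf_sum (sum_single (fun j => t * phi y (d _ (val j)))).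
  (* The vector is the coboundary, read on [F], of the cochain with value [t] at [y] and 0
     elsewhere, so [chi G] kills it. *)
  apply: (chiP G).1; exists (fun x => if x == elt y then t else 0) => j.
  rewrite diff_opE coord_opE.
  rewrite [RHS](@eq_sum_support _ _ _ _ [:: y]) ?uniq_s // => [|z /phi0 ->|z].
  - by rewrite big_seq1 eqxx.
  - exact: scale0r.
  - by rewrite inE eq_Tagged => /negPf /= ->; exact: scaler0.
have [eta etaE] := (tensor_exact (character_module_injective divE) xi).1 d_xi.
have [L etaL] := tensor_sum eta.
(* This [G] makes [dd (h G)] vanish on all first factors of [eta], so pairing with [e (h G)] through
   [b] kills the boundary [xi]. *)
pose G : seq X := [seq elt q.1 | q <- L].
pose b (p : P (m + 1)) (q : character_module R E (seq X)) :=
  (e (h G) (elt p) : R) *: q.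
have bal : balanced b.
  have lin := coord_op_linear phi_linear uniq_s phi0 (h G) (n := m + 1).
  have /exists_linear[g gE] := lin.
  split=> [p p' q|p q q'|p r q]; rewrite /b -?gE.
  - by rewrite raddfD scalerDl.
  - by rewrite scalerDr.
  - by rewrite linearZ scalerA.
have : tensor_lift b xi = 0.
  rewrite -etaE etaL (zmod_morphism_sum _ _ (@tensor_mapB _ _ _ (d m) _)).
  rewrite (zmod_morphism_sum _ _ (tensor_lift_is_zmod_morphism bal)).
  rewrite big_seq big1 // => q qL; rewrite tensor_mapE (tensor_liftE bal) /b.
  rewrite -diff_opE (hP G).1 ?scale0r //.
  by apply/mapP; exists q.
rewrite (zmod_morphism_sum _ _ (tensor_lift_is_zmod_morphism bal)).
under eq_bigr => j _ do rewrite (tensor_liftE bal) /b.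
(* The component at [G] of the vanishing pairing, evaluated at 1, is [chi G] of the restriction of
   [e (h G)] to [F], which was chosen non-zero. *)
move=> sum0; apply: (chiP G).2; rewrite -(sum_single (fun j => e (h G) (elt (val j)))).
rewrite raddf_sum; transitivity ((0 : character_module R E (seq X)) G 1) => //.
rewrite -sum0 character_sumE; apply: eq_bigr => j _.
by rewrite characterZE mul1r.
Qed.

Lemma solvable_over_regular F :
  exists G, solvable_over (dsupp d s) (supp s) (dcoef d phi) (coef phi) RR F G.
Proof. exact/solvable_over_graded/solvable_over_regular_graded. Qed.

End Regular.

(** * Exactness of Hom and vanishing of Ext *)

Lemma hom_exact_PGF (R : pzRingType) (P : int -> rmodType R)
    (d : forall n, {linear P n -> P (n + 1)}) (D : rmodType R) :
    (forall n, projective (P n)) -> acyclic_complex d ->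
    (forall I : lmodType R, injective_module I ->
       forall n, exact (tensor_map (d n) (N := I)) (tensor_map (d (n + 1)) (N := I))) ->
    definable_closure (fun M => M = regular_rmodule R) D \/ projective D ->
  forall n, hom_exact D (d n) (d (n + 1)).
Proof.
move=> projP acyc tensP DP.
have [phi phiP] := pi_choice (fun n => dual_basis (projP n)).
have [s sP] := pi_choice phiP.
have phi_linear n y : linear (phi n y : P n -> (R^c)^o) by case: (sP n).
have uniq_s n p : uniq (s n p) by case: (sP n).
have phi0 n p y : y \notin s n p -> phi n y p = 0 by case: (sP n) => _ _ + _; apply.
have phiE n p : p = \sum_(y <- s n p) phi n y p *: y by case: (sP n).
apply: (hom_exact_of_solvable phi_linear uniq_s phi0 phiE) => [n p|F].
  by apply: (acyc n _).2; exists p.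
have [G solR] := solvable_over_regular phi_linear uniq_s phi0 phiE tensP F.
(* The [G] found for the ring also serves [D]: with [F] and [G] fixed, solvability is a definable
   class containing the ring, and it passes to projectives. *)
exists G; case: DP => [clD|projD]; last exact: solvable_over_projective.
by apply: (clD _ (definable_solvable _ _ _ _ F G)) => _ ->.
Qed.

(* A map out of the image of Q_1 in Q_0 is transported to the complex P along
   lifts of the identity of K, extended there, and transported back. *)
Lemma Ext1_eq0_syzygy (S : pzRingType) (P : int -> lmodType S)
    (d : forall n, {linear P n -> P (n + 1)}) (K D : lmodType S) :
    (forall n, projective (P n)) -> acyclic_complex d -> is_syzygy d K ->
    (forall n, hom_exact D (d n) (d (n + 1))) ->
  Ext1_eq0 K D.
Proof.
move=> projP acyc [n [i [i_inj iE]]] homD Q delta eps [projQ eps_surj ex0 exS] h.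
(* Three degrees below [n] leave room for the start [P m -> P (m+1) -> P (m+2) -> K] of a
   resolution. *)
have [m mE] : exists m : int, m + 1 + 1 + 1 = n by exists (n - 1 - 1 - 1); rewrite !subrK.
case: n / mE i i_inj iE => i i_inj iE.
have dd0 l p : d (l + 1) (d l p) = 0 by apply: (acyc l _).2; exists p.
have /choice[kap kapE] p : exists a, i a = d (m + 1 + 1) p.
  exact: (iE _).1 (dd0 _ _).
have /exists_linear[kappa kappaE] : linear kap.
  by move=> a p q; apply: i_inj; rewrite linearP !kapE linearP.
have kappa_surj : surjective_fun kappa.
  move=> a; have [|p pE] := (acyc _ (i a)).1; first by apply: (iE _).2; exists a.
  by exists p; apply: i_inj; rewrite kappaE kapE.
have kappa0 p : kappa p = 0 -> exists q, d (m + 1) q = p.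
  by move=> p0; apply: (acyc _ _).1; rewrite -kapE -kappaE p0 raddf0.
have kappad q : kappa (d (m + 1) q) = 0.
  by apply: i_inj; rewrite kappaE kapE dd0 raddf0.
have [g gE] := projP _ _ _ eps kappa eps_surj.
have [f fE] := projQ 0%N _ _ kappa eps kappa_surj.
split; last first.
  by move=> [k kE] a; rewrite -kE (_ : delta 0%N _ = 0) ?raddf0 //; apply: (exS 0%N _).2; exists a.
move=> hd.
have h_eq y y' : delta 0%N y = delta 0%N y' -> h y = h y'.
  move=> yy'; apply/eqP; rewrite -subr_eq0 -raddfB.
  have [|a <-] := (exS 0%N (y - y')).1; last exact/eqP/hd.
  by rewrite raddfB /= yy' subrr.
(* [pre] is a set-theoretic section of [delta 0] over the kernel of [eps]; [h] composed with it is
   linear there, since [h] kills the kernel of [delta 0]. *)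
have /choice[pre preE] z : exists y, eps z = 0 -> delta 0%N y = z.
  have [/(ex0 z).1[y yE]|nz] := pselect (eps z = 0); first by exists y.
  by exists 0 => /nz.
have hpre_linear a z z' : eps z = 0 -> eps z' = 0 ->
    h (pre (a *: z + z')) = a *: h (pre z) + h (pre z').
  move=> z0 z'0; rewrite -linearP; apply: h_eq.
  by rewrite linearP !preE // linearP z0 z'0 scaler0 addr0.
have epsg q : eps (g (d (m + 1) q)) = 0 by rewrite gE kappad.
have /exists_linear[h' h'E] : linear (fun q => h (pre (g (d (m + 1) q)))).
  by move=> a q q'; rewrite !linearP hpre_linear.
have [|k kE] := (homD m h').1.
  move=> a; rewrite h'E dd0 raddf0 -[RHS](raddf0 h); apply: h_eq.
  by rewrite preE ?raddf0.
have epsK q : eps (q - g (f q)) = 0 by rewrite raddfB /= gE fE subrr.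
(* [g] after [f] is the identity only modulo the kernel of [eps]; the second summand corrects this
   by evaluating [h] on the difference. *)
have /exists_linear[t tE] : linear (fun q => k (f q) + h (pre (q - g (f q)))).
  move=> a q q'; rewrite !linearP [X in pre X]addrACA -scalerDr hpre_linear //.
  by rewrite scalerDr addrACA.
exists t => b; rewrite tE.
have epsb : eps (delta 0%N b) = 0 by apply: (ex0 _).2; exists b.
have /kappa0[q qE] : kappa (f (delta 0%N b)) = 0 by rewrite fE.
rewrite -qE kE h'E -raddfD; apply: h_eq.
by rewrite raddfD /= !preE ?epsg // ?qE ?epsK // addrC subrK.
Qed.

Theorem theorem3p4 (R : pzRingType) (K : rmodType R) :
  PGF K ->
  left_orthogonal (definable_closure (fun M => M = regular_rmodule R)) K /\
  Gorenstein_projective K.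
Proof.
move=> [P [d [projP acyc tensP syzK]]]; split=> [D clD|].
  apply: (Ext1_eq0_syzygy projP acyc syzK).
  by apply: hom_exact_PGF => //; left.
exists P, d; split=> // Q projQ.
by apply: hom_exact_PGF => //; right.
Qed.
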